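(* For every $k\in\{0,1,\dots,d\}$, the $k$-th Grassmann angle valuation $G_k(\cdot)$ is a translation-invariant valuation on $\mathcal P(\mathbb Z^d)$. Moreover, for all $P\in\mathcal P(\mathbb Z^d)$ we have: (1) $G_0(P)=L(P)-1$; (2) $G_{d-1}(P)=A(P)$; (3) $G_d(P)=0$; (4) if $\dim P=k$, then $$0=G_d(P)=\dots=G_k(P)\le G_{k-1}(P)\le G_{k-2}(P)\le\dots\le G_0(P)=L(P)-1.$$
   Context: $\mathcal P(\mathbb Z^d)$ is the set of all convex lattice polytopes in $\mathbb R^d$ (convex hulls of finitely many points of $\mathbb Z^d$), including the empty set. $\dim P$ is the dimension of the affine hull of $P$ (with the convention $\dim\emptyset=0$). $L(P)=|P\cap\mathbb Z^d|=\sum_{v\in\mathbb Z^d}\mathbf 1[v\in P]$ is the number of integer points in $P$. A function $\varphi:\mathcal P(\mathbb Z^d)\to\mathbb R$ is a valuation if $\varphi(\emptyset)=0$ and $\varphi(P\cup Q)=\varphi(P)+\varphi(Q)-\varphi(P\cap Q)$ for all $P,Q\in\mathcal P(\mathbb Z^d)$ with $P\cup Q\in\mathcal P(\mathbb Z^d)$. It is translation-invariant if $\varphi(t+P)=\varphi(P)$ for all $P\in\mathcal P(\mathbb Z^d)$, $t\in\mathbb Z^d$. For $v\in P$, the tangent cone is $T_v(P)=\operatorname{pos}(P-v)=\{\lambda(x-v):x\in P,\lambda\ge0\}$. For a polyhedral cone $C$, the solid angle $\alpha(C)$ is the probability that a random vector uniformly distributed on the unit sphere of the linear hull of $C$ lies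 in $C$; $\alpha(\{0\})=1$. The solid-angle valuation is $A(P)=\sum_{v\in P\cap\mathbb Z^d}\alpha(T_v(P))$ if $\dim P=d$, and $A(P)=0$ otherwise. Let $W_m$ be a random $m$-dimensional linear subspace of $\mathbb R^d$ distributed according to the rotation-invariant (Haar) probability measure on the Grassmannian, let $U$ be uniformly distributed on the unit sphere $\mathbb S^{d-1}$ independently of $W_m$, and let $W_m^+=W_m\cap\{x\in\mathbb R^d:\langle x,U\rangle\ge0\}$ be the corresponding random closed half-subspace. For a convex cone $C\subseteq\mathbb R^d$ and $k\in\{0,\dots,d\}$, the $k$-th modified Grassmann angle is $\alpha_k(C)=\mathbb P[C\cap W_{d-k}^+\ne\{0\}]$. The $k$-th Grassmann angle valuation is $$G_k(P)=\sum_{v\in P\cap\mathbb Z^d}\alpha_k(T_v(P)).$$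
   Formalization: The equality G_0(P)=L(P)-1 in (1) and at the end of (4) is stated only for nonempty P, since for P=∅ one has G_0(∅)=0 but L(∅)-1=-1; d≥1 is assumed so that the sphere S^{d-1} and the index d-1 make sense. *)

(* Defs.v *)
From mathcomp Require Import all_boot all_order all_algebra.
From mathcomp Require Import all_classical all_reals all_analysis.
Set Implicit Arguments.
Unset Strict Implicit.
Unset Printing Implicit Defensive.
Import Order.TTheory GRing.Theory Num.Theory.
Import numFieldNormedType.Exports.
Local Open Scope classical_set_scope.
Local Open Scope ring_scope.

Section Geometry.
Context {R : realType} {d : nat}.
Local Notation E := 'rV[R]_d.
Implicit Types (A C Q : set E) (V L : {vspace E}).

Definition dotp (x y : E) : R := (x *m y^T) 0 0.

(* The linear hull of a set, as the least subspace containing it; see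
   [lin_hullP] for existence. *)
Definition is_lin_hull A V : Prop :=
  (forall x, A x -> x \in V) /\
  (forall V' : {vspace E}, (forall x, A x -> x \in V') -> (V <= V')%VS).

Definition lin_hull A : {vspace E} := xget 0%VS (is_lin_hull A).

Lemma lin_hullP A : is_lin_hull A (lin_hull A).
Proof.
suff [V hV] : exists V, is_lin_hull A V by exact: (xgetPex 0%VS (ex_intro _ V hV)).
pose p n := `[< exists2 s : seq E, (forall x, x \in s -> A x) & \dim << s >> = n >].
have p0 : exists n, p n.
  by exists 0; apply/asboolP; exists [::] => //; rewrite span_nil dimv0.
have pd n : p n -> (n <= \dim {:E})%N.
  by move=> /asboolP[s _ <-]; rewrite dimvS ?subvf.
case: (ex_maxnP p0 pd) => n /asboolP[s sA <-] smax.
exists << s >>%VS; split => [x Ax|V' AV'].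
  have xsA y : y \in x :: s -> A y by rewrite inE => /orP[/eqP ->|/sA].
  have /smax xs : p (\dim <<x :: s>>) by apply/asboolP; exists (x :: s).
  have ss : (<< s >> <= <<x :: s>>)%VS by rewrite span_cons addvSr.
  have /eqP -> : << s >>%VS == <<x :: s>>%VS by rewrite eqEdim ss xs.
  by rewrite memv_span ?mem_head.
by apply/span_subvP => x /sA /AV'.
Qed.

Definition aff_hull A : set E :=
  [set x | exists (n : nat) (a : 'I_n -> E) (c : 'I_n -> R),
    [/\ forall i, A (a i), \sum_i c i = 1 & x = \sum_i c i *: a i]].

(* The dimension of a flat is that of its direction space; the empty flat
   gets dimension 0. *)
Definition flat_dim A : nat := \dim (lin_hull [set x - y | x in A & y in A]).

Definition poly_dim Q : nat := flat_dim (aff_hull Q).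

Definition conv_hull (n : nat) (a : 'I_n -> E) : set E :=
  [set x | exists c : 'I_n -> R,
    [/\ forall i, 0 <= c i, \sum_i c i = 1 & x = \sum_i c i *: a i]].

Definition lattice : set E := range (fun z : 'rV[int]_d => map_mx intr z).

(* n = 0 gives the empty polytope. *)
Definition lattice_polytope Q : Prop :=
  exists (n : nat) (a : 'I_n -> E),
    (forall i, lattice (a i)) /\ Q = conv_hull a.

Definition num_points Q : R := \sum_(v \in Q `&` lattice) (1 : R).

Definition is_valuation (phi : set E -> R) : Prop :=
  phi set0 = 0 /\
  forall Q1 Q2, lattice_polytope Q1 -> lattice_polytope Q2 ->
    lattice_polytope (Q1 `|` Q2) ->
    phi (Q1 `|` Q2) = phi Q1 + phi Q2 - phi (Q1 `&` Q2).

Definition translation_invariant (phi : set E -> R) : Prop :=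
  forall Q (t : E), lattice_polytope Q -> lattice t ->
    phi [set t + x | x in Q] = phi Q.

Definition tangent_cone Q (v : E) : set E :=
  [set y | exists x (lam : R), [/\ Q x, 0 <= lam & y = lam *: (x - v)]].

Definition half_subspace V (u : E) : set E :=
  [set x | x \in V /\ 0 <= dotp x u].

Definition orthogonal_mx (g : 'M[R]_d) : Prop := g *m g^T = 1%:M.

Definition rotate (g : 'M[R]_d) V : {vspace E} :=
  (linfun (mulmxr g : E -> E) @: V)%VS.

Definition orth_compl V : {vspace E} :=
  lin_hull [set x | forall y, y \in V -> dotp x y = 0].

(* Matrix (acting on row vectors) of the orthogonal projection onto V. The
   Grassmannian carries the topology, hence the Borel sigma-algebra, pulled
   back from matrices along this embedding. *)
Definition orth_proj V : 'M[R]_d := lin1_mx (daddv_pi V (orth_compl V)).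

End Geometry.

Notation borel T := (g_sigma_algebraType (@open T)).

Section RandomGeometry.
Context {R : realType} {d : nat} {disp : measure_display}.
Context {Omega : measurableType disp} (P : probability Omega R).
Local Notation E := 'rV[R]_d.
Implicit Types (U : Omega -> E) (W : Omega -> {vspace E}) (L : {vspace E}).

(* The uniform distribution on the unit sphere of L is the unique Borel
   probability measure on it invariant under the orthogonal group of L;
   every isometry of L extends to an orthogonal g stabilizing L. *)
Definition uniform_on_sphere L U : Prop :=
  [/\ measurable_fun setT (U : Omega -> borel 'rV[R]_d),
      forall w, U w \in L /\ dotp (U w) (U w) = 1
    & forall g : 'M[R]_d, orthogonal_mx g -> rotate g L = L ->
      forall B : set (borel 'rV[R]_d), measurable B ->
      P [set w | B (U w *m g)] = P [set w | B (U w)] ].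

Definition uniform_subspace (m : nat) W : Prop :=
  [/\ measurable_fun setT ((fun w => orth_proj (W w)) : Omega -> borel 'M[R]_d),
      forall w, \dim (W w) = m
    & forall g : 'M[R]_d, orthogonal_mx g ->
      forall B : set (borel 'M[R]_d), measurable B ->
      P [set w | B (orth_proj (rotate g (W w)))] =
      P [set w | B (orth_proj (W w))] ].

Definition independent W U : Prop :=
  forall (B : set (borel 'M[R]_d)) (B' : set (borel 'rV[R]_d)),
    measurable B -> measurable B' ->
    P [set w | B (orth_proj (W w)) /\ B' (U w)] =
    (P [set w | B (orth_proj (W w))] * P [set w | B' (U w)])%E.

(* Theta L plays the role of a uniform random vector on the unit sphere of L. *)
Definition solid_angle (Theta : {vspace E} -> Omega -> E) (C : set E) : R :=
  if `[< C = [set 0] >] then 1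
  else fine (P [set w | C (Theta (lin_hull C) w)]).

Definition solid_angle_val (Theta : {vspace E} -> Omega -> E) (Q : set E) : R :=
  if poly_dim Q == d then
    \sum_(v \in Q `&` lattice) solid_angle Theta (tangent_cone Q v)
  else 0.

(* W m plays the role of W_m. *)
Definition grassmann_angle (W : nat -> Omega -> {vspace E}) U
    (k : nat) (C : set E) : R :=
  fine (P [set w | C `&` half_subspace (W (d - k)%N w) (U w) <> [set 0]]).

Definition grassmann_val (W : nat -> Omega -> {vspace E}) U
    (k : nat) (Q : set E) : R :=
  \sum_(v \in Q `&` lattice) grassmann_angle W U k (tangent_cone Q v).

End RandomGeometry.

(* Main.v *)
(** Almost all the content is in the laws of the random subspaces.  A law
    on a metric space which is invariant under a transitive group of isometries
    is unique (double counting of the pairs of points at distance [< r], then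
    [r -> 0]); this applies to the unit sphere under O(d), and to the
    Grassmannian, realised by orthogonal projections, under conjugation.  Since
    a fixed hyperplane has probability 0, adding to [W m] the line spanned by
    an independent uniform vector gives a random subspace of dimension [m + 1]
    with an invariant law, hence the law of [W m.+1].  By induction on [m], a
    fixed subspace of dimension at most [d - m] meets [W m] only at the origin;
    and the coupling [W m <= W m.+1] shows that the angles decrease with [k].

    For the valuation property, at a common point [v] of [Q1] and [Q2] a
    half-subspace meeting both tangent cones outside the origin contains a
    segment joining [Q1] to [Q2], which crosses their intersection; if the
    segment contains [v], one first moves it into the open half-space, which is
    almost surely possible.  [G 0] counts the lattice points except the almost
    surely unique maximiser of [<., U>], and the ray [W 1]^+ is spanned by the
    projection of [U] onto [W 1], whose direction is uniform on the sphere. *)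
From HB Require Import structures.
Require Import Defs.
From mathcomp Require Import all_boot all_order all_algebra.
From mathcomp Require Import all_classical all_reals all_analysis.
From mathcomp Require Import measurable_realfun.
From mathcomp Require Import zify ring lra.
Set Implicit Arguments.
Unset Strict Implicit.
Unset Printing Implicit Defensive.
Import Order.TTheory GRing.Theory Num.Theory.
Import numFieldNormedType.Exports.
Local Open Scope classical_set_scope.
Local Open Scope ring_scope.

(** * Orthogonal projections and reflections *)

Section InnerProduct.
Context {R : realType} {d : nat}.
Local Notation E := 'rV[R]_d.
Implicit Types (x y z : E) (g h : 'M[R]_d) (V L : {vspace E}).

(** Nothing relates the [W m] for different [m] pointwise: each is given only by its own law and its
    independence of [U]. Hence [W m] and [W m.+1] can be compared only in law, and the vector added
    to [W m] is taken from the second factor of [P \x P]. The same passage to [P \x P] turns the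
    independence of [W m] and [U] into Tonelli's theorem, so that almost sure statements are proved
    with one of the two variables frozen. The second obstacle is measurability: the events assert
    the existence of a vector in a cone and in a random subspace. They are restated with points of
    the compact polytope instead of vectors of its tangent cone, and with a matrix equation instead
    of membership, after which compactness reduces the existential to countably many rational
    points. *)

Lemma dotpE x y : dotp x y = \sum_i x 0 i * y 0 i.
Proof. by rewrite /dotp mxE; apply: eq_bigr => i _; rewrite mxE. Qed.

Lemma dotpC x y : dotp x y = dotp y x.
Proof. by rewrite !dotpE; apply: eq_bigr => i _; rewrite mulrC. Qed.

Lemma dotpDl x y z : dotp (x + y) z = dotp x z + dotp y z.
Proof. by rewrite /dotp mulmxDl mxE. Qed.

Lemma dotpZl a x z : dotp (a *: x) z = a * dotp x z.
Proof. by rewrite /dotp -scalemxAl mxE. Qed.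

Lemma dotpNl x z : dotp (- x) z = - dotp x z.
Proof. by rewrite -scaleN1r dotpZl mulN1r. Qed.

Lemma dotpBl x y z : dotp (x - y) z = dotp x z - dotp y z.
Proof. by rewrite dotpDl dotpNl. Qed.

Lemma dotpDr x y z : dotp x (y + z) = dotp x y + dotp x z.
Proof. by rewrite dotpC dotpDl !(dotpC x). Qed.

Lemma dotpZr a x z : dotp x (a *: z) = a * dotp x z.
Proof. by rewrite dotpC dotpZl dotpC. Qed.

Lemma dotpBr x y z : dotp x (y - z) = dotp x y - dotp x z.
Proof. by rewrite dotpC dotpBl !(dotpC x). Qed.

Lemma dot0p x : dotp 0 x = 0.
Proof. by rewrite -(scale0r 0) dotpZl mul0r. Qed.

Lemma dotp0 x : dotp x 0 = 0.
Proof. by rewrite dotpC dot0p. Qed.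

Lemma dotp_suml (I : Type) (r : seq I) (f : I -> E) z :
  dotp (\sum_(i <- r) f i) z = \sum_(i <- r) dotp (f i) z.
Proof. by rewrite /dotp mulmx_suml summxE. Qed.

Lemma dotpp_ge0 x : 0 <= dotp x x.
Proof. by rewrite dotpE; apply: sumr_ge0 => i _; rewrite -expr2 sqr_ge0. Qed.

Lemma dotpp_eq0 x : (dotp x x == 0) = (x == 0).
Proof.
apply/idP/eqP => [|->]; last by rewrite dot0p.
rewrite dotpE psumr_eq0 => [/allP h|i _]; last by rewrite -expr2 sqr_ge0.
apply/rowP => i; rewrite mxE; apply/eqP.
by have := h i; rewrite mem_index_enum /= mulf_eq0 orbb; apply.
Qed.

Lemma dotpp_gt0 x : (0 < dotp x x) = (x != 0).
Proof. by rewrite lt_def dotpp_eq0 dotpp_ge0 andbT. Qed.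

Lemma dotp_mulmxl x y g : dotp (x *m g) y = dotp x (y *m g^T).
Proof. by rewrite /dotp trmx_mul trmxK mulmxA. Qed.

Lemma orthogonal_tr g : orthogonal_mx g -> g^T *m g = 1%:M.
Proof. by move=> /mulmx1C. Qed.

Lemma orthogonal_dotp g x y :
  orthogonal_mx g -> dotp (x *m g) (y *m g) = dotp x y.
Proof. by move=> og; rewrite dotp_mulmxl -mulmxA og mulmx1. Qed.

Lemma orthogonal_mulmx g h :
  orthogonal_mx g -> orthogonal_mx h -> orthogonal_mx (g *m h).
Proof.
move=> og oh; rewrite /orthogonal_mx trmx_mul mulmxA -(mulmxA g) oh mulmx1.
exact: og.
Qed.

Lemma mem_rotate g V x : orthogonal_mx g ->
  (x \in rotate g V) = (x *m g^T \in V).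
Proof.
move=> og; apply/memv_imgP/idP => [[y yV ->]|xV].
  by rewrite lfunE /= -mulmxA og mulmx1.
by exists (x *m g^T) => //; rewrite lfunE /= -mulmxA orthogonal_tr// mulmx1.
Qed.

(** Being a kernel, the set of vectors orthogonal to [V] is already a subspace, so that [lin_hull]
    adds nothing to it in [orth_compl], and rank-nullity bounds its dimension. *)
Lemma orth_ker V : exists f : 'Hom(E, 'rV[R]_(\dim V)),
  forall x, (x \in lker f) <-> (forall y, y \in V -> dotp x y = 0).
Proof.
pose B : 'M[R]_(\dim V, d) := \matrix_i (vbasis V)`_i.
exists (linfun (mulmxr B^T : 'rV[R]_d -> 'rV[R]_(\dim V))) => x.
have xBE i : (x *m B^T) 0 i = dotp x (vbasis V)`_i.
  by rewrite mxE dotpE; apply: eq_bigr => j _; rewrite !mxE.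
rewrite memv_ker lfunE /=; split => [/eqP/rowP xB y yV|h].
  rewrite (coord_vbasis yV) dotpC dotp_suml big1// => i _.
  by rewrite dotpZl dotpC -xBE xB mxE mulr0.
apply/eqP/rowP => i; rewrite xBE mxE h//.
by apply: vbasis_mem; rewrite mem_nth// size_tuple.
Qed.

Lemma orth_complP V x :
  reflect (forall y, y \in V -> dotp x y = 0) (x \in orth_compl V).
Proof.
have [h1 h2] := lin_hullP [set x : E | forall y, y \in V -> dotp x y = 0].
apply: (iffP idP) => [xV|]; last exact: h1.
have [f fP] := orth_ker V; by apply/fP; apply: (subvP (h2 _ _)) xV => y /fP.
Qed.

Lemma dim_rV : \dim {:E} = d.
Proof. by rewrite dimvf /dim /= mul1n. Qed.

Lemma dim_orth_compl_ge V : (d <= \dim V + \dim (orth_compl V))%N.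
Proof.
have [f fP] := orth_ker V.
have <- : lker f = orth_compl V.
  by apply/vspaceP => y; apply/idP/orth_complP => /fP.
have := limg_ker_dim f fullv; rewrite capfv dim_rV /= => e.
apply: leq_trans (eq_leq (esym e)) _; rewrite addnC leq_add2r.
by apply: leq_trans (dimvS (subvf _)) _; rewrite dimvf /dim /= mul1n.
Qed.

Lemma cap_orth_compl V : (V :&: orth_compl V = 0)%VS.
Proof.
apply/eqP; rewrite -subv0; apply/subvP =>
  x /memv_capP[xV /orth_complP/(_ _ xV)].
by move=> /eqP; rewrite dotpp_eq0 memv0.
Qed.

Lemma add_orth_compl V : (V + orth_compl V = fullv)%VS.
Proof.
apply/eqP; rewrite eqEdim subvf /= dimv_disjoint_sum ?cap_orth_compl//.
by rewrite dim_rV dim_orth_compl_ge.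
Qed.

Lemma dim_orth_compl V : (\dim V + \dim (orth_compl V))%N = d.
Proof. by rewrite -dimv_disjoint_sum ?cap_orth_compl// add_orth_compl dim_rV.
  Qed.

Lemma mulmx_orth_proj V x : x *m orth_proj V = daddv_pi V (orth_compl V) x.
Proof. by rewrite /orth_proj mul_rV_lin1. Qed.

Lemma orth_proj_mem V x : x *m orth_proj V \in V.
Proof. by rewrite mulmx_orth_proj memv_pi. Qed.

Lemma orth_proj_id V x : x \in V -> x *m orth_proj V = x.
Proof. by move=> xV; rewrite mulmx_orth_proj daddv_pi_id// cap_orth_compl. Qed.

Lemma orth_projP V x : (x \in V) = (x *m orth_proj V == x).
Proof.
by apply/idP/eqP => [/orth_proj_id//|<-]; rewrite orth_proj_mem.
Qed.

Lemma orth_proj_compl V x y : y \in V -> dotp (x - x *m orth_proj V) y = 0.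
Proof.
move=> yV; suff /orth_complP : x - x *m orth_proj V \in orth_compl V by apply.
have xE : x \in (V + orth_compl V)%VS by rewrite add_orth_compl memvf.
have := daddv_pi_add (cap_orth_compl V) xE.
by rewrite -mulmx_orth_proj => /(canRL (addKr _)) e; rewrite addrC -e memv_pi.
Qed.

(** The two candidate images differ by a vector of [V] that is also a difference of residuals, hence
    orthogonal to itself. Projections onto rotated and enlarged subspaces are identified this
    way. *)
Lemma orth_proj_uniq V (p : 'M[R]_d) : (forall x, x *m p \in V) ->
  (forall x y, y \in V -> dotp (x - x *m p) y = 0) -> p = orth_proj V.
Proof.
move=> pV pC; apply/row_matrixP => i; rewrite !rowE; set x := delta_mx _ _.
apply/eqP; rewrite -subr_eq0 -dotpp_eq0; set n := _ - _.
have nV : n \in V by rewrite rpredB ?pV ?orth_proj_mem.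
have nE : n = (x - x *m orth_proj V) - (x - x *m p).
  by rewrite /n opprB [RHS]addrC subrKA.
by rewrite {1}nE dotpBl pC// orth_proj_compl// subr0.
Qed.

Lemma orth_proj_dotp V x y : dotp (x *m orth_proj V) y =
  dotp x (y *m orth_proj V).
Proof.
have h u v : dotp (u *m orth_proj V) v =
  dotp (u *m orth_proj V) (v *m orth_proj V).
  apply/eqP; rewrite -subr_eq0 -dotpBr dotpC orth_proj_compl//.
  exact: orth_proj_mem.
by rewrite h -[RHS]dotpC [RHS]h dotpC.
Qed.

Lemma dim_rotate g V : orthogonal_mx g -> \dim (rotate g V) = \dim V.
Proof.
move=> og; apply: limg_dim_eq; apply/eqP; rewrite -subv0.
apply/subvP => x /memv_capP[_]; rewrite memv_ker lfunE /= memv0 => /eqP xg.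
by rewrite -dotpp_eq0 -(orthogonal_dotp x x og) xg dot0p.
Qed.

Lemma orth_proj_rotate g V : orthogonal_mx g ->
  orth_proj (rotate g V) = g^T *m orth_proj V *m g.
Proof.
move=> og; symmetry; apply: orth_proj_uniq => [x|x y].
  by rewrite mem_rotate// -!mulmxA og mulmx1 mulmxA orth_proj_mem.
rewrite mem_rotate// => /(orth_proj_compl (x *m g^T)) <-.
by rewrite -dotp_mulmxl mulmxBl -!mulmxA (orthogonal_tr og) mulmx1.
Qed.

(* Householder reflection; since [2 / 0 = 0],
  it is the identity when [z = 0]. *)
Definition refl_mx z : 'M[R]_d := 1%:M - (2 / dotp z z) *: (z^T *m z).

Lemma mul_refl_mx x z : x *m refl_mx z = x - (2 * dotp x z / dotp z z) *: z.
Proof.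
rewrite /refl_mx mulmxBr mulmx1 -scalemxAr mulmxA.
rewrite [x *m z^T]mx11_scalar -/(dotp x z) mul_scalar_mx scalerA.
by congr (_ - _ *: _); rewrite mulrAC.
Qed.

Lemma orthogonal_refl z : orthogonal_mx (refl_mx z).
Proof.
rewrite /orthogonal_mx; have -> : (refl_mx z)^T = refl_mx z.
  by rewrite /refl_mx linearB /= linearZ /= trmx1 trmx_mul trmxK.
apply/row_matrixP => i; rewrite !rowE mulmxA mulmx1 mul_refl_mx.
set x := delta_mx _ _; have [->|z0] := eqVneq z 0;
  first by rewrite scaler0 subr0 mul_refl_mx scaler0 subr0.
rewrite mul_refl_mx dotpBl dotpZl -addrA -opprD -scalerDl.
have zz : dotp z z != 0 by rewrite dotpp_eq0.
by set a := (X in X *: _); rewrite (_ : a = 0) ?scale0r ?subr0// /a; field.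
Qed.

(** For vectors of equal norm, [dotp (x - y) (x - y)] is [2 * dotp x (x - y)], so exactly one copy
    of [x - y] is subtracted from [x]. *)
Lemma refl_swap x y : dotp x x = dotp y y -> x *m refl_mx (x - y) = y.
Proof.
move=> e; have [->|xy] := eqVneq x y.
  by rewrite mul_refl_mx subrr scaler0 subr0.
rewrite mul_refl_mx (_ : _ / _ = 1) ?scale1r ?subKr//.
have h : dotp (x - y) (x - y) != 0 by rewrite dotpp_eq0 subr_eq0.
apply: (mulIf h); rewrite mulfVK// !dotpBr !dotpBl -e (dotpC y); ring.
Qed.

Lemma refl_fix v z : dotp v z = 0 -> v *m refl_mx z = v.
Proof. by move=> e; rewrite mul_refl_mx e mulr0 mul0r scale0r subr0. Qed.

Lemma sphere_transitive x y : dotp x x = dotp y y ->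
  exists2 g, orthogonal_mx g & x *m g = y.
Proof.
by move=> e; exists (refl_mx (x - y));
  [exact: orthogonal_refl|exact: refl_swap].
Qed.

Lemma rotate_mulmx g h V : orthogonal_mx g -> orthogonal_mx h ->
  rotate h (rotate g V) = rotate (g *m h) V.
Proof.
move=> og oh; apply/vspaceP => x.
by rewrite !mem_rotate//; [rewrite trmx_mul mulmxA|exact: orthogonal_mulmx].
Qed.

Lemma orthogonal1 : orthogonal_mx (1%:M : 'M[R]_d).
Proof. by rewrite /orthogonal_mx trmx1 mulmx1. Qed.

Lemma exists_unit_orth V L : (\dim L < \dim V)%N ->
  exists x, [/\ x \in V, x \in orth_compl L & dotp x x = 1].
Proof.
move=> LV.
have /eqP/eqP : (V :&: orth_compl L)%VS != 0%VS.
  rewrite -dimv_eq0; apply/eqP => e0.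
  have := dimvS (subvf (V + orth_compl L)%VS).
  rewrite dim_rV dimv_disjoint_sum; last by apply/eqP; rewrite -dimv_eq0 e0.
  move=> /leq_trans/(_ (eq_leq (esym (dim_orth_compl L)))).
  by rewrite leq_add2r leqNgt LV.
rewrite -vpick0; set x := vpick _ => x0.
have /memv_capP[xV xL] := memv_pick (V :&: orth_compl L)%VS.
exists ((Num.sqrt (dotp x x))^-1 *: x); split; rewrite ?memvZ//.
rewrite dotpZl dotpZr mulrA -invfM -expr2 sqr_sqrtr ?dotpp_ge0// mulVf//.
by rewrite dotpp_eq0.
Qed.

(** Induction on the codimension in [L] of its intersection [N] with the rotated [V]. Given unit
    vectors [x] of the rotated [V] and [y] of [L], both orthogonal to [N], the reflection carrying
    [x] to [y] fixes [N], so the new intersection contains [N + <[y]>]. *)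
Lemma grassmannian_transitive V L : \dim V = \dim L ->
  exists2 g, orthogonal_mx g & rotate g V = L.
Proof.
move=> VL.
suff [g og gV] : exists2 g, orthogonal_mx g & (L <= rotate g V)%VS.
  exists g => //; apply/eqP; rewrite eq_sym eqEdim gV/=.
  by rewrite -VL dim_rotate.
have : exists n, (\dim L - \dim (rotate 1%:M V :&: L) <= n)%N.
  by eexists; exact: leqnn.
move=> [n]; have := orthogonal1; move: 1%:M => g og.
elim: n g og => [|n IH] g og.
  rewrite leqn0 subn_eq0 => Lg; exists g => //.
  have /eqP <- : (rotate g V :&: L == L)%VS by rewrite eqEdim capvSr.
  exact: capvSl.
have [Lg _|gL] := leqP (\dim L) (\dim (rotate g V :&: L)).
  exists g => //; have /eqP <- : (rotate g V :&: L == L)%VS by rewrite eqEdim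
    capvSr.
  exact: capvSl.
set N := (rotate g V :&: L)%VS in gL * => Nn.
have [x [xV xN x1]] : exists x, [/\ x \in rotate g V,
  x \in orth_compl N & dotp x x = 1].
  by apply: exists_unit_orth; rewrite dim_rotate// VL.
have [y [yL yN y1]] := exists_unit_orth gL.
pose h := refl_mx (x - y); have oh : orthogonal_mx h := orthogonal_refl _.
apply: (IH (g *m h)); first exact: orthogonal_mulmx.
rewrite -rotate_mulmx//.
have NyS : (N + <[y]> <= rotate h (rotate g V) :&: L)%VS.
  apply/subvP => _ /memv_addP[u uN [_ /vlineP[a ->] ->]]; apply: rpredD.
    have /memv_capP[ug uL] := uN; rewrite memv_cap uL andbT.
    apply/memv_imgP; exists u => //; rewrite lfunE /= refl_fix//.
    rewrite dotpBr dotpC (orth_complP _ _ xN)// dotpC (orth_complP _ _ yN)//.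
    by rewrite subr0.
  rewrite memvZ// memv_cap yL andbT.
  by apply/memv_imgP; exists x => //; rewrite lfunE /= refl_swap// x1.
have yN0 : (N :&: <[y]> = 0)%VS.
  apply/eqP; rewrite -subv0; apply/subvP => u0 /memv_capP[uN /vlineP[a e]].
  move: uN; rewrite e => uN; have := orth_complP _ _ yN _ uN.
  by rewrite dotpZr y1 mulr1 => ->; rewrite scale0r mem0v.
have := dimvS NyS; rewrite dimv_disjoint_sum// dim_vline.
have -> : y != 0 by rewrite -dotpp_eq0 y1 oner_eq0.
rewrite addn1 => NS; rewrite leq_subLR (leq_trans _ (leq_add NS (leqnn _)))//.
by move: Nn; rewrite leq_subLR addSn addnS.
Qed.

(** The projection gains the rank-one projection onto the residual [n]. When [u] lies in [V] the
    residual is zero, the added term vanishes, and the formula remains valid. *)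
Lemma orth_proj_add V u (n := u - u *m orth_proj V) :
  orth_proj (V + <[u]>)%VS = orth_proj V + (dotp n n)^-1 *: (n^T *m n).
Proof.
have nE : n = u - u *m orth_proj V by [].
have nV y : y \in V -> dotp n y = 0 by exact: orth_proj_compl.
clearbody n.
have mulE x : x *m (orth_proj V + (dotp n n)^-1 *: (n^T *m n)) =
    x *m orth_proj V + (dotp x n / dotp n n) *: n.
  rewrite mulmxDr -scalemxAr mulmxA [x *m n^T]mx11_scalar -/(dotp x n).
  by rewrite mul_scalar_mx scalerA mulrC.
have nVu : n \in (V + <[u]>)%VS.
  rewrite nE addrC memv_add ?memv_line// rpredN; exact: orth_proj_mem.
symmetry; apply: orth_proj_uniq => x.
  rewrite mulE rpredD ?memvZ//.
  by apply: (subvP (addvSl _ _)); exact: orth_proj_mem.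
move=> _ /memv_addP[y yV [_ /vlineP[a ->] ->]]; rewrite mulE.
(* Modulo [V], [u] may be replaced by [n], which is orthogonal to [V]. *)
have -> : y + a *: u = (y + a *: (u *m orth_proj V)) + a *: n.
  by rewrite -addrA -scalerDr nE subrKC.
have yV' : y + a *: (u *m orth_proj V) \in V.
  by rewrite rpredD// memvZ// orth_proj_mem.
rewrite opprD addrA [LHS]dotpBl [in LHS]dotpZl.
rewrite [dotp n (_ + _)]dotpDr [dotp (x - _) (_ + _)]dotpDr (nV _ yV').
rewrite orth_proj_compl// !add0r.
rewrite ![dotp _ (a *: n)]dotpZr dotpBl (dotpC (x *m _)) (nV (x *m
  _)) ?orth_proj_mem// subr0.
have [->|n0] := eqVneq n 0; first by rewrite !dotp0 !mulr0 subr0.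
by field; rewrite dotpp_eq0.
Qed.

Lemma dim_add_line V u : u \notin V -> \dim (V + <[u]>)%VS = (\dim V).+1.
Proof.
move=> uV; rewrite dimv_disjoint_sum ?dim_vline.
  have -> : u != 0 by apply: contraNneq uV => ->; rewrite mem0v.
  by rewrite addn1.
apply/eqP; rewrite -subv0; apply/subvP => u0 /memv_capP[xV /vlineP[a e]].
move: xV; rewrite e; have [->|a0] := eqVneq a 0;
  first by rewrite scale0r !mem0v.
by rewrite rpredZeq (negbTE a0) (negbTE uV).
Qed.

Lemma exists_normal V : (\dim V < d)%N ->
  exists2 x, x != 0 & forall y, y \in V -> dotp y x = 0.
Proof.
move=> Vd; have [|x [_ /orth_complP xV x1]] := @exists_unit_orth fullv V.
  by rewrite dim_rV.
exists x => [|y yV]; first by rewrite -dotpp_eq0 x1 oner_eq0.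
by rewrite dotpC xV.
Qed.

End InnerProduct.

(** * Borel measurability on matrix spaces *)

Lemma continuous_sumr {R : realType} (T : topologicalType) (I : Type)
    (r : seq I) (f : I -> T -> R) :
  (forall i, continuous (f i)) -> continuous (fun x => \sum_(i <- r) f i x).
Proof.
move=> cf; elim: r => [|i r IH].
  rewrite (_ : (fun x => _) = fun=> 0); last by apply/funext => y;
    rewrite big_nil.
  by move=> x; exact: cvg_cst.
rewrite (_ : (fun x => _) = (fun x => f i x + \sum_(j <- r) f j x)).
  by move=> x; apply: cvgD; [exact: cf|exact: IH].
by apply/funext => y; rewrite big_cons.
Qed.

Section BorelMatrices.
Context {R : realType}.
Local Notation borelM p q := (borel 'M[R]_(p, q)).

Lemma measurable_preim d d' (T : measurableType d) (T' : measurableType d')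
    (Z : T -> T') (B : set T') :
  measurable_fun setT Z -> measurable B -> measurable (Z @^-1` B).
Proof. by move=> mZ mB; rewrite -[X in measurable X]setTI; exact: mZ. Qed.

Lemma measurable_set_lt d (T : measurableType d) (f : T -> R) (a : R) :
  measurable_fun setT f -> measurable [set t | f t < a].
Proof.
move=> mf; have := mf measurableT `]-oo, a[%classic (measurable_itv _).
by rewrite setTI; congr (measurable _); apply/seteqP; split => t /=;
  rewrite in_itv.
Qed.

Lemma measurable_set_eq d (T : measurableType d) (f : T -> R) (a : R) :
  measurable_fun setT f -> measurable [set t | f t = a].
Proof.
move=> mf; have := mf measurableT [set a] (measurable_set1 a).
by rewrite setTI.
Qed.

Lemma open_borel (T : ptopologicalType) (B : set T) :
  open B -> measurable (B : set (borel T)).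
Proof. by move=> oB; apply: sub_sigma_algebra. Qed.

Lemma closed_borel (T : ptopologicalType) (B : set T) :
  closed B -> measurable (B : set (borel T)).
Proof.
move=> cB; rewrite -(setCK B); apply: measurableC; apply: open_borel.
exact: closed_openC.
Qed.

Lemma continuous_borel (T : ptopologicalType) (f : T -> R) :
  continuous f -> measurable_fun setT (f : borel T -> R).
Proof.
move=> /continuousP cf; apply: (measurability _ (RGenOpens.measurableE R)).
move=> _ [_ [a [b ->] <-]]; rewrite setTI; apply: open_borel.
exact/cf/interval_open.
Qed.

Lemma measurable_coord p q i j :
  measurable_fun setT ((fun x => x i j) : borelM p q -> R).
Proof. by apply: continuous_borel; exact: coord_continuous. Qed.

Lemma mx_ballP p q (x y : 'M[R]_(p, q)) (e : R) :
  ball x e y <-> 0 < e /\ forall i j, `|x i j - y i j| < e.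
Proof. by []. Qed.

Lemma rat_mx_dense p q (x : 'M[R]_(p, q)) (e : R) : 0 < e ->
  exists r : 'M[rat]_(p, q), ball x e (map_mx ratr r).
Proof.
move=> e0.
have h (i : 'I_p * 'I_q) : exists r : rat, `|x i.1 i.2 - ratr r| < e.
  have /rat_in_itvoo[r] : x i.1 i.2 - e < x i.1 i.2 + e by lra.
  rewrite in_itv/= => /andP[r1 r2]; exists r.
  by rewrite ltr_norml; apply/andP; split; lra.
have /choice[f fP] := h.
exists (\matrix_(i, j) f (i, j)); apply/mx_ballP; split => // i j.
by rewrite !mxE; exact: (fP (i, j)).
Qed.

Lemma natSinv_lt (e : R) : 0 < e ->
  exists N : nat, forall n, (N <= n)%N -> n.+1%:R^-1 < e.
Proof.
by move=> e0; have [N _ NP] := @near_infty_natSinv_lt R (PosNum e0); exists N.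
Qed.

(** Every open set is a countable union of balls with rational centres, and a ball, taken for the
    entrywise norm, is a finite intersection of conditions on single entries. *)
Lemma measurable_mx d (T : measurableType d) p q (f : T -> borelM p q) :
  (forall i j, measurable_fun setT (fun t => (f t : 'M[R]_(p, q)) i j)) ->
  measurable_fun setT f.
Proof.
move=> mf; apply: (@measurability _ _ T (borelM p q) setT f (@open 'M[R]_(p,
  q)) erefl) => _ [B oB <-]; rewrite setTI.
pose V (rn : 'M[rat]_(p, q) * nat) := ball (map_mx ratr rn.1 : 'M[R]_(p,
  q)) (rn.2.+1%:R^-1).
have -> : f @^-1` B = \bigcup_(rn : 'M[rat]_(p, q) * nat)
    [set t | V rn (f t) /\ V rn `<=` B].
  apply/seteqP; split => t /=; last by move=> [rn _ [Vt VB]]; exact: VB.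
  move=> Bt; have /nbhs_ballP[e /= e0 eB] := open_nbhs_nbhs (conj oB Bt).
  have [n /(_ n (leqnn n)) ne] := natSinv_lt (divr_gt0 e0 (ltr0Sn R 1)).
  have n0 : 0 < n.+1%:R^-1 :> R by rewrite invr_gt0.
  have [r rP] := rat_mx_dense (f t) n0.
  exists (r, n) => //; split; first exact: ball_sym.
  move=> y /= ry; apply: eB; apply: (@le_ball _ _ _ (n.+1%:R^-1 + n.+1%:R^-1)).
    by rewrite (splitr e) lerD// ltW.
  exact: ball_triangle rP ry.
apply: countable_bigcupT_measurable => [|rn]; first exact: countableP.
have [VB|VB] := pselect (V rn `<=` B); last first.
  rewrite (_ : mkset _ = set0); first exact: measurable0.
  by apply/seteqP; split => t //= [].
rewrite (_ : mkset _ = \bigcap_(ij in [set: 'I_p * 'I_q])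
  [set t | (`|(map_mx ratr rn.1 : 'M[R]_(p,
    q)) ij.1 ij.2 - f t ij.1 ij.2| < rn.2.+1%:R^-1)]); last first.
  apply/seteqP; split => t /=.
    by move=> [/mx_ballP[_ h] _] [i j] _ /=.
  move=> h; split => //; apply/mx_ballP; split; first by rewrite invr_gt0.
  by move=> i j; exact: (h (i, j)).
apply: fin_bigcap_measurable; first exact: finite_finset.
move=> [i j] _ /=; apply: measurable_set_lt.
apply: measurableT_comp => //; apply: measurable_funB => //.
Qed.

(* By compactness, it suffices that for every [n] some rational point at
   distance less than [1 / n] from [K] satisfies [F t x < 1 / n]. *)
Lemma compact_exists_measurable d (T : measurableType d) p q
    (K : set 'M[R]_(p, q)) (F : T -> 'M[R]_(p, q) -> R) :
  compact K -> (forall x, measurable_fun setT (F^~ x)) ->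
  (forall t, continuous (F t)) ->
  measurable [set t | exists2 x, K x & F t x <= 0].
Proof.
move=> cK mF cF.
pose G (n : nat) (r : 'M[rat]_(p, q)) : set T :=
  [set t | (exists2 x, K x & ball x n.+1%:R^-1 (map_mx ratr r)) /\
           F t (map_mx ratr r) < n.+1%:R^-1].
rewrite (_ : mkset _ = \bigcap_n \bigcup_r G n r); last first.
  apply/seteqP; split => t /=.
    move=> [x Kx Fx] n _.
    have : \forall y \near x, F t y < n.+1%:R^-1.
      have : F t x < n.+1%:R^-1 by rewrite (le_lt_trans Fx)// invr_gt0.
      by move=> h; exact: (cvgr_lt (F t x) (cF t x)).
    move=> /nbhs_ballP[e /= e0 eF].
    have m0 : 0 < Num.min e n.+1%:R^-1 by rewrite lt_min e0 invr_gt0 /=.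
    have [r rP] := rat_mx_dense x m0.
    exists r => //; split.
      by exists x => //; apply: le_ball rP; rewrite ge_min lexx orbT.
    by apply: eF; apply: le_ball rP; rewrite ge_min lexx.
  move=> h.
  have {h}/choice[f fP] : forall n : nat, exists rx : 'M[rat]_(p,
    q) * 'M[R]_(p, q),
      [/\ K rx.2, ball rx.2 n.+1%:R^-1 (map_mx ratr rx.1) & F t (map_mx ratr
        rx.1) < n.+1%:R^-1].
    by move=> n; have [r _ [[x Kx xr] Fr]] := h n I; exists (r, x).
  have [|x [Kx xc]] := cK ((fun n => (f n).2) @ \oo) _.
    by exists 0%N => // n _; have [] := fP n.
  (* Around a cluster point with positive value, [F t] would exceed [F t x / 2], while rational
     points arbitrarily close to it have values below [n.+1%:R^-1] for large [n]. *)
  exists x => //; rewrite leNgt; apply/negP => Fx.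
  have : \forall y \near x, F t x / 2 < F t y.
    by apply: (cvgr_gt (F t x) (cF t x)); lra.
  move=> /nbhs_ballP[e /= e0 eF].
  have m0 : 0 < Num.min (e / 2) (F t x / 2) by rewrite lt_min !divr_gt0.
  have [N NP] := natSinv_lt m0.
  have [] := xc [set y | exists2 n, (N <= n)%N & y = (f n).2] (ball x (e / 2)).
  - by exists N => // n /= Nn; exists n.
  - by apply: nbhsx_ballx; rewrite divr_gt0.
  - move=> _ [[n Nn ->] xn]; have [Kn bn Fn] := fP n.
    have := NP n Nn; rewrite /= lt_min => /andP[n1 n2].
    have : ball x e (map_mx ratr (f n).1 : 'M[R]_(p, q)).
      rewrite (splitr e); apply: ball_triangle xn _.
      by apply: le_ball bn; exact: ltW.
    by move=> /eF /= h2; have := lt_trans h2 (lt_trans Fn n2); rewrite ltxx.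
apply: bigcapT_measurable => n.
apply: countable_bigcupT_measurable => [|r]; first exact: countableP.
(* The first condition in [G n r] does not involve [t], so [G n r] is either empty or a sublevel set
   of a measurable function. *)
have [Kr|Kr] := pselect (exists2 x,
  K x & ball x n.+1%:R^-1 (map_mx ratr r : 'M[R]_(p, q))); last first.
  rewrite (_ : G n r = set0); first exact: measurable0.
  by apply/seteqP; split => t //= [].
rewrite (_ : G n r = [set t | F t (map_mx ratr r) < n.+1%:R^-1]).
  exact: measurable_set_lt.
by apply/seteqP; split => t /= => [[]|].
Qed.

End BorelMatrices.

(** * Product laws and uniqueness of invariant laws *)

Section Laws.
Context {R : realType}.

(** Uniqueness of measures on a pi-system, applied to the two image laws: the pi-system is that of
    rectangles in [prod_law] and that of open sets in [invariant_law_unique]. *)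
Lemma same_law dT d1 d2 (T : measurableType dT) (O1 : measurableType d1)
    (O2 : measurableType d2) (P1 : probability O1 R) (P2 : probability O2 R)
    (X : O1 -> T) (Y : O2 -> T) (G : set (set T)) :
  measurable_fun setT X -> measurable_fun setT Y ->
  measurable = <<s G >> -> setI_closed G -> G setT ->
  (forall A, G A -> P1 (X @^-1` A) = P2 (Y @^-1` A)) ->
  forall A, measurable A -> P1 (X @^-1` A) = P2 (Y @^-1` A).
Proof.
move=> mX mY mG GI GT h A mA.
pose X' : {mfun O1 >-> T} := HB.pack_for {mfun O1 >-> T} X
  (isMeasurableFun.Build _ _ _ _ _ mX).
pose Y' : {mfun O2 >-> T} := HB.pack_for {mfun O2 >-> T} Y
  (isMeasurableFun.Build _ _ _ _ _ mY).
apply: (measure_unique G (fun=> setT) mG GI _ _ (distribution P1 X')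
  (distribution P2 Y')) => //.
- by apply/seteqP; split => // t _; exists 0%N.
- by move=> _; rewrite [ltLHS]probability_setT ltry.
Qed.

Lemma prod_law dA dB d1 d2 d3 (A : measurableType dA) (B : measurableType dB)
    (O1 : measurableType d1) (O2 : measurableType d2) (O3 : measurableType d3)
    (P1 : probability O1 R) (P2 : probability O2 R) (P3 : probability O3 R)
    (X : O1 -> A) (Y : O2 -> B) (Z : O3 -> A * B) :
  measurable_fun setT X -> measurable_fun setT Y -> measurable_fun setT Z ->
  (forall S T, measurable S -> measurable T ->
    P3 (Z @^-1` (S `*` T)) = (P1 (X @^-1` S) * P2 (Y @^-1` T))%E) ->
  forall C, measurable C ->
    P3 (Z @^-1` C) = (P1 \x P2)%E ((fun w => (X w.1, Y w.2)) @^-1` C).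
Proof.
move=> mX mY mZ h.
apply: (@same_law _ _ _ _ _ _ P3 (P1 \x P2)%E Z (fun w => (X w.1, Y w.2))
  [set C | exists S, measurable S /\ exists T,
    measurable T /\ C = S `*` T]) => //.
- apply: measurable_fun_pair; first exact: measurableT_comp mX measurable_fst.
  exact: measurableT_comp mY measurable_snd.
- rewrite measurable_prod_measurableType //; congr (<<s _ >>).
  rewrite predeqE; split => [[S mS [T mT <-]]|[S [mS [T [mT ->]]]]].
    by exists S; split => //; exists T.
  by exists S => //; exists T.
- move=> _ _ [X1 [mX1 [X2 [mX2 ->]]]] [Y1 [mY1 [Y2 [mY2 ->]]]].
  rewrite -setXI; exists (X1 `&` Y1); split; first exact: measurableI.
  by exists (X2 `&` Y2); split => //; exact: measurableI.
- by exists setT; split => //; exists setT; split => //; rewrite setXTT.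
- move=> _ [S [mS [T [mT ->]]]]; rewrite h//.
  by rewrite -product_measure1E//; exact: measurable_preim.
Qed.

(** Tonelli with an exceptional set: the sections over [N] are unconstrained, but [N] times the
    second space is itself null. *)
Lemma product_null d1 d2 (O1 : measurableType d1) (O2 : measurableType d2)
    (P1 : probability O1 R) (P2 : probability O2 R) (A : set (O1 * O2))
    (N : set O1) :
  measurable A -> measurable N -> P1 N = 0%E ->
  (forall w, ~ N w -> P2 (xsection A w) = 0%E) -> (P1 \x P2)%E A = 0%E.
Proof.
move=> mA mN N0 h; apply/eqP; rewrite eq_le measure_ge0 andbT.
have mNT : measurable (N `*` [set: O2]) by exact: measurableX.
have mD : measurable (A `\` N `*` [set: O2]) by exact: measurableD.
apply: (@le_trans _ _ ((P1 \x P2)%E ((N `*` setT) `|` (A `\` N `*` setT)))).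
  apply: le_measure; rewrite ?inE//; first exact: measurableU.
  by move=> w Aw; have [|] := pselect ((N `*` [set: O2]) w); [left|right].
apply: (le_trans (measureU2 _ _ _)) => //.
have e1 : (P1 \x P2)%E (N `*` [set: O2]) = 0%E.
  by rewrite product_measure1E//= N0 mul0e.
suff e2 : (P1 \x P2)%E (A `\` N `*` [set: O2]) = 0%E.
  by rewrite -[leRHS](adde0 0%E); apply: leeD; rewrite le_eqVlt; apply/orP;
    left; apply/eqP.
rewrite /product_measure1 integral0_eq//= => w _.
have [Nw|/h Nw] := pselect (N w).
  rewrite (_ : xsection _ _ = set0) ?measure0//.
  by apply/seteqP; split => y //=; rewrite /xsection /= inE => -[_ []].
apply/eqP; rewrite eq_le measure_ge0 andbT -Nw; apply: le_measure; rewrite ?inE.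
- exact: measurable_xsection.
- exact: measurable_xsection.
- by move=> y; rewrite /xsection /= !inE => -[].
Qed.

Lemma product_measure_swap d1 d2 (O1 : measurableType d1)
    (O2 : measurableType d2)
    (P1 : probability O1 R) (P2 : probability O2 R) (A : set (O1 * O2)) :
  measurable A -> (P1 \x P2)%E A = (\int[P2]_y P1 (ysection A y))%E.
Proof.
rewrite -[RHS]/((P1 \x^ P2)%E A); move: A.
by apply: product_measure_unique => //= ? ? ? ?; rewrite product_measure2E.
Qed.

End Laws.

Section InvariantLaw.
Context {R : realType} {p q : nat}.
Local Notation M := 'M[R]_(p, q).

(** The squared Frobenius distance. Orthogonal transformations preserve it, unlike the entrywise
    norm behind [ball]. Squaring avoids roots, at the price of a factor [2] in the triangle
    inequality. *)
Definition sqdist (x y : M) : R := \sum_i \sum_j (x i j - y i j) ^+ 2.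

Lemma sqdistC x y : sqdist x y = sqdist y x.
Proof.
by apply: eq_bigr => i _; apply: eq_bigr => j _; rewrite -sqrrN opprB.
Qed.

Lemma sqdistxx x : sqdist x x = 0.
Proof. by rewrite /sqdist big1// => i _; rewrite big1// => j _;
  rewrite subrr expr0n. Qed.

Lemma sqdist_triangle x y z : sqdist x z <= 2 * (sqdist x y + sqdist y z).
Proof.
rewrite /sqdist -big_split/= mulr_sumr; apply: ler_sum => i _.
rewrite -big_split/= mulr_sumr; apply: ler_sum => j _.
rewrite -subr_ge0 (_ : _ - _ = ((x i j - y i j) - (y i j - z i j)) ^+ 2)
  ?sqr_ge0//.
by ring.
Qed.

Lemma sqdist_ball x y (e : R) : 0 < e -> sqdist x y < e ^+ 2 -> ball x e y.
Proof.
move=> e0 xy; apply/mx_ballP; split => // i j.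
rewrite -(ltr_pXn2r (ltn0Sn 1)) ?nnegrE ?(ltW e0)// real_normK ?num_real//.
apply: le_lt_trans xy; rewrite /sqdist (bigD1 i)//= (bigD1 j)//= -addrA lerDl.
by apply: addr_ge0; repeat (apply: sumr_ge0 => ? _); rewrite ?sqr_ge0.
Qed.

Lemma ball_sqdist (e : R) : 0 < e ->
  exists2 r : R, 0 < r & forall x y : M, ball x r y -> sqdist x y < e.
Proof.
(* Each of the [p * q] entries contributes at most [e / n], since squaring decreases numbers below
   [1]; the [+ 1] keeps [n] positive and the final bound strict. *)
move=> e0; pose n : R := (p * q)%:R + 1.
have n0 : 0 < n by rewrite ltr_wpDl.
exists (Num.min 1 (e / n)); first by rewrite lt_min ltr01 divr_gt0.
move=> x y /mx_ballP[r0 xy].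
apply: (@le_lt_trans _ _ (\sum_(i < p) \sum_(j < q) (e / n))).
  apply: ler_sum => i _; apply: ler_sum => j _.
  have := xy i j; rewrite lt_min => /andP[xy1 xye].
  rewrite -[_ ^+ 2]ger0_norm ?sqr_ge0// normrX expr2.
  by rewrite (le_trans _ (ltW xye))// ler_piMl// ltW.
rewrite !sumr_const !card_ord -mulrnA -[X in X < _]mulr_natl mulnC mulrA.
by rewrite ltr_pdivrMr// mulrC ltr_pM2l// /n ltrDl.
Qed.

Lemma measurable_sqdist d (T : measurableType d) (f g : T -> borel M) :
  measurable_fun setT f -> measurable_fun setT g ->
  measurable_fun setT (fun t => sqdist (f t) (g t)).
Proof.
move=> mf mg; rewrite /sqdist; apply: measurable_sum => i.
apply: measurable_sum => j; apply: measurable_funX; apply: measurable_funB.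
  exact: measurableT_comp (measurable_coord i j) mf.
exact: measurableT_comp (measurable_coord i j) mg.
Qed.

Definition sqball (x : M) (r : R) : set (borel M) := [set y | sqdist x y < r].

Section Comparison.
Context d1 d2 (O1 : measurableType d1) (O2 : measurableType d2).
Context (P1 : probability O1 R) (P2 : probability O2 R).
Context (X : O1 -> borel M) (Y : O2 -> borel M).
Context (S : set M) (G : set (M -> M)).
Hypotheses (mX : measurable_fun setT X) (mY : measurable_fun setT Y).
Hypothesis G_isom : forall g, G g -> forall x y,
  sqdist (g x) (g y) = sqdist x y.
Hypothesis G_trans : forall x y, S x -> S y -> exists2 g, G g & g x = y.
Hypotheses (SX : forall w, S (X w)) (SY : forall w, S (Y w)).
Hypothesis X_inv : forall g, G g -> forall B : set (borel M), measurable B ->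
  P1 [set w | B (g (X w))] = P1 [set w | B (X w)].
Hypothesis Y_inv : forall g, G g -> forall B : set (borel M), measurable B ->
  P2 [set w | B (g (Y w))] = P2 [set w | B (Y w)].

Lemma measurable_sqball (x : M) r : measurable (sqball x r).
Proof. by apply: measurable_set_lt; exact: measurable_sqdist. Qed.

Lemma sqball_constX x y r : S x -> S y ->
  P1 (X @^-1` sqball x r) = P1 (X @^-1` sqball y r).
Proof.
move=> Sx Sy; have [g Gg <-] := G_trans Sx Sy.
rewrite -[RHS](X_inv Gg (measurable_sqball (g x) r)).
by congr (P1 _); apply/seteqP; split => w; rewrite /sqball /= G_isom.
Qed.

Lemma sqball_constY x y r : S x -> S y ->
  P2 (Y @^-1` sqball x r) = P2 (Y @^-1` sqball y r).
Proof.
move=> Sx Sy; have [g Gg <-] := G_trans Sx Sy.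
rewrite -[RHS](Y_inv Gg (measurable_sqball (g x) r)).
by congr (P2 _); apply/seteqP; split => w; rewrite /sqball /= G_isom.
Qed.

(* Double counting of the pairs at distance less than [r]: the two masses of an
   [r]-ball do not depend on the centre in [S]. *)
Lemma double_counting (V B : set (borel M)) (x0 : M) (r : R) : S x0 ->
  measurable V -> measurable B ->
  (forall x y, V x -> sqdist x y < r -> B y) ->
  (P1 [set w | V (X w)] * P2 (Y @^-1` sqball x0 r) <=
   P2 [set w | B (Y w)] * P1 (X @^-1` sqball x0 r))%E.
Proof.
move=> Sx0 mV mB VB.
pose D := [set w : O1 * O2 | sqdist (X w.1) (Y w.2) < r].
have mD : measurable D.
  apply: measurable_set_lt; apply: measurable_sqdist.
    exact: measurableT_comp mX measurable_fst.
  exact: measurableT_comp mY measurable_snd.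
have mV' : measurable [set w : O1 * O2 | V (X w.1)].
  by apply: (@measurable_preim _ _ _ _ (fun w : O1 * O2 => X w.1)) => //;
    exact: measurableT_comp mX measurable_fst.
have mB' : measurable [set w : O1 * O2 | B (Y w.2)].
  by apply: (@measurable_preim _ _ _ _ (fun w : O1 * O2 => Y w.2)) => //;
    exact: measurableT_comp mY measurable_snd.
have lhsE : (P1 \x P2)%E ([set w | V (X w.1)] `&` D) =
    (P1 [set w | V (X w)] * P2 (Y @^-1` sqball x0 r))%E.
  rewrite /product_measure1 (eq_integral (fun w =>
    (\1_[set w | V (X w)] w)%:E * P2 (Y @^-1` sqball x0 r))%E).
    rewrite ge0_integralZr//.
    - by rewrite integral_indic// ?setIT//; exact: measurable_preim.
    - by apply/measurable_EFinP; apply: measurable_indic;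
        exact: measurable_preim.
  move=> w _ /=; rewrite indicE; have [Vw|Vw] := boolP (w \in _);
    rewrite ?mul1e ?mul0e.
    rewrite inE /= in Vw; rewrite -(sqball_constY r (SX w) Sx0).
    by congr (P2 _); apply/seteqP; split => y;
      rewrite /xsection /sqball /= inE //= => -[].
  rewrite (_ : xsection _ _ = set0) ?measure0//; apply/seteqP; split => y //.
  rewrite /xsection /= inE /= => -[Vw' _].
  by move/negP: Vw; apply; rewrite inE.
have rhsE : (P1 \x P2)%E ([set w | B (Y w.2)] `&` D) =
    (P2 [set w | B (Y w)] * P1 (X @^-1` sqball x0 r))%E.
  rewrite product_measure_swap; last exact: measurableI.
  rewrite (eq_integral (fun w => (\1_[set w | B (Y w)] w)%:E * P1 (X @^-1`
    sqball x0 r))%E).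
    rewrite ge0_integralZr//.
    - by rewrite integral_indic// ?setIT//; exact: measurable_preim.
    - by apply/measurable_EFinP; apply: measurable_indic;
        exact: measurable_preim.
  move=> w _ /=; rewrite indicE; have [Vw|Vw] := boolP (w \in _);
    rewrite ?mul1e ?mul0e.
    rewrite inE /= in Vw; rewrite -(sqball_constX r (SY w) Sx0).
    by congr (P1 _); apply/seteqP; split => y;
      rewrite /ysection /sqball /= inE //= sqdistC => // -[].
  rewrite (_ : ysection _ _ = set0) ?measure0//; apply/seteqP; split => y //.
  rewrite /ysection /= inE /= => -[Vw' _].
  by move/negP: Vw; apply; rewrite inE.
rewrite -lhsE -rhsE; apply: le_measure; rewrite ?inE; try exact: measurableI.
by move=> [w1 w2] [/= Vw Dw]; split => //=; exact: VB Vw Dw.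
Qed.

(** If one [r]-ball centred in [S] were null, all would be. A ball of squared radius [r / 4] around
    a rational point, if it contains a value [Y w0], lies in the [r]-ball around [Y w0], the [4]
    absorbing the factor of [sqdist_triangle]. Countably many null events would then cover the whole
    space. *)
Lemma sqball_gt0 x0 r : 0 < r -> S x0 -> (0 < P2 (Y @^-1` sqball x0 r))%E.
Proof.
move=> r0 Sx0; rewrite lt0e measure_ge0 andbT; apply/eqP => e0.
have [e e_gt0 eP] := ball_sqdist (divr_gt0 r0 (ltr0Sn R 3)).
pose F (n : nat) : set O2 := if unpickle n is Some z
  then Y @^-1` sqball (map_mx ratr (z : 'M[rat]_(p, q))) (r / 4) else set0.
have mF n : measurable (F n).
  rewrite /F; case: unpickle => [z|]; last exact: measurable0.
  by apply: measurable_preim => //; exact: measurable_sqball.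
have nF n : P2 (F n) = 0%E.
  rewrite /F; case: unpickle => [z|]; last exact: measure0.
  have [[w0 w0z]|h] := pselect (exists w0,
    sqdist (map_mx ratr z) (Y w0) < r / 4); last first.
    rewrite (_ : _ @^-1` _ = set0) ?measure0//.
    by apply/seteqP; split => w //= wz; apply: h; exists w.
  apply/eqP; rewrite eq_le measure_ge0 andbT -e0 (sqball_constY r Sx0 (SY w0)).
  apply: le_measure; rewrite ?inE.
  - by apply: measurable_preim => //; exact: measurable_sqball.
  - by apply: measurable_preim => //; exact: measurable_sqball.
  rewrite /sqball => w /= wz; apply: le_lt_trans (sqdist_triangle _ (map_mx
    ratr z) _) _.
  by move: w0z wz; rewrite (sqdistC (Y w0)); lra.
have : P2 (\bigcup_n F n) = 0%E.
  apply: measure_negligible; first exact: bigcupT_measurable.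
  by apply: negligible_bigcup => n; apply/negligibleP; [exact: mF|exact: nF].
rewrite (_ : bigcup _ _ = setT) ?probability_setT; first by move/eqP;
  rewrite onee_eq0.
apply/seteqP; split => // w _.
have [z zP] := rat_mx_dense (Y w) e_gt0.
exists (pickle z) => //; rewrite /F pickleK /sqball /= sqdistC.
exact: eP.
Qed.

(** The unconstrained case of double counting. Exchanging the two random variables gives the reverse
    inequality, so that a ball centred in [S] has the same mass under both laws. *)
Lemma sqball_le x0 r : S x0 ->
  (P2 (Y @^-1` sqball x0 r) <= P1 (X @^-1` sqball x0 r))%E.
Proof.
move=> Sx0; have := @double_counting setT setT x0 r Sx0 measurableT measurableT.
have -> : [set w | [set: borel M] (X w)] = setT by apply/seteqP; split.
have -> : [set w | [set: borel M] (Y w)] = setT by apply/seteqP; split.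
by rewrite !probability_setT !mul1e; apply.
Qed.

(** [V n] keeps the points of [B] at squared distance at least [n.+1%:R^-1] from its complement.
    Double counting at that radius compares [V n] under the first law with [B] under the second; the
    positive ball mass cancels, and the sets [V n] increase to [B]. *)
Lemma invariant_law_le (B : set M) : open B ->
  (forall x0 r, S x0 -> P1 (X @^-1` sqball x0 r) <= P2 (Y @^-1` sqball x0 r))%E
    ->
  (P1 [set w | B (X w)] <= P2 [set w | B (Y w)])%E.
Proof.
move=> oB leb.
have [[w0 _]|noO] := pselect (exists w : O1, True); last first.
  rewrite (_ : mkset _ = set0) ?measure0 ?measure_ge0//.
  by apply/seteqP; split => w // _; apply: noO; exists w.
have S0 := SX w0; set x0 := X w0 in S0.
pose V (n : nat) : set M := [set x | forall y, sqdist x y < n.+1%:R^-1 -> B y].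
have mV n : measurable (V n : set (borel M)).
  apply: closed_borel; rewrite -(setCK (V n)); apply: open_closedC.
  rewrite (_ : ~` V n = \bigcup_(y in ~` B) sqball y n.+1%:R^-1).
    apply: bigcup_open => y _; apply: (@open_comp _ _ (sqdist y) [set r | r <
      n.+1%:R^-1]).
      move=> x _; apply: continuous_sumr => {x} i;
        apply: continuous_sumr => j x.
      apply: (@continuous_comp _ _ _ (fun x : M =>
        y i j - x i j) (fun r : R => r ^+ 2)).
        by apply: (@continuousB _ R^o);
          [exact: cst_continuous|exact: coord_continuous].
      exact: exprn_continuous.
    exact: open_lt.
  apply/seteqP; split => x /=.
    move=> /existsNP[y /not_implyP[xy By]]; exists y => //.
    by rewrite /sqball /= sqdistC.
  by move=> [y By]; rewrite /sqball /= sqdistC => xy Vx; apply: By; exact: Vx.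
have hV n : (P1 [set w | V n (X w)] <= P2 [set w | B (Y w)])%E.
  have n0 : 0 < n.+1%:R^-1 :> R by rewrite invr_gt0.
  have mB := open_borel oB.
  have := @double_counting (V n) B x0 n.+1%:R^-1 S0 (mV n) mB (fun x y Vx =>
    Vx y).
  move=> /le_trans/(_ (lee_wpmul2l (measure_ge0 _ _) (leb _ _ S0))).
  rewrite lee_pmul2r//; last exact: sqball_gt0.
  by rewrite fin_num_measure//; apply: measurable_preim => //;
    exact: measurable_sqball.
have VB : \bigcup_n [set w | V n (X w)] = [set w | B (X w)].
  apply/seteqP; split => w /=.
    by move=> [n _ /= Vw]; apply: Vw; rewrite sqdistxx invr_gt0.
  move=> Bw; have /nbhs_ballP[e /= e0 eB] := open_nbhs_nbhs (conj oB Bw).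
  have [n /(_ n (leqnn n)) ne] := natSinv_lt (exprn_gt0 2 e0).
  exists n => // y /= yn; apply: eB; apply: sqdist_ball => //.
  exact: lt_trans ne.
have : (fun n => P1 [set w | V n (X w)]) @ \oo --> P1 (\bigcup_n [set w | V n
  (X w)]).
  apply: nondecreasing_cvg_mu.
  - by move=> n; exact: measurable_preim.
  - by apply: bigcupT_measurable => n; exact: measurable_preim.
  - move=> m n mn; apply/subsetPset => w /= Vw y yn; apply: Vw.
    by apply: lt_le_trans yn _; rewrite lef_pV2 ?posrE// ler_nat.
rewrite VB => cV; have := cvg_lim (@ereal_hausdorff R) cV => <-.
apply: lime_le; first by apply/cvg_ex; eexists; exact: cV.
by exists 0%N => // n _; exact: hV.
Qed.
End Comparison.

Theorem invariant_law_unique d1 d2 (O1 : measurableType d1)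
    (O2 : measurableType d2) (P1 : probability O1 R) (P2 : probability O2 R)
    (X : O1 -> borel M) (Y : O2 -> borel M) (S : set M) (G : set (M -> M)) :
  measurable_fun setT X -> measurable_fun setT Y ->
  (forall g, G g -> forall x y, sqdist (g x) (g y) = sqdist x y) ->
  (forall x y, S x -> S y -> exists2 g, G g & g x = y) ->
  (forall w, S (X w)) -> (forall w, S (Y w)) ->
  (forall g, G g -> forall B : set (borel M), measurable B ->
    P1 [set w | B (g (X w))] = P1 [set w | B (X w)]) ->
  (forall g, G g -> forall B : set (borel M), measurable B ->
    P2 [set w | B (g (Y w))] = P2 [set w | B (Y w)]) ->
  forall B : set (borel M), measurable B ->
    P1 [set w | B (X w)] = P2 [set w | B (Y w)].
Proof.
move=> mX mY Gi Gt SX SY iX iY.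
apply: (@same_law _ _ _ _ _ _ _ P1 P2 X Y (@open M)) => //.
- exact: openI.
- exact: openT.
- move=> B oB; apply/eqP; rewrite eq_le; apply/andP; split.
    apply: (invariant_law_le mX mY Gi Gt SX SY iX iY) => // x0 r.
    exact: (sqball_le mY mX Gi Gt SY SX iY iX).
  apply: (invariant_law_le mY mX Gi Gt SY SX iY iX) => // x0 r.
  exact: (sqball_le mX mY Gi Gt SX SY iX iY).
Qed.

End InvariantLaw.

(** * Measurable matrix operations and null sets *)

Section MeasurableMatrixOps.
Context {R : realType} {disp : measure_display} {T : measurableType disp}.

Lemma measurable_inv_real : measurable_fun setT (fun x : R => x^-1).
Proof.
have -> : [set: R] = [set x | x != 0] `|` [set 0].
  by apply/seteqP; split => x // _ /=; have [->|] := eqVneq x 0; [right|left].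
have oD : open [set x : R | x != 0].
  rewrite (_ : mkset _ = ~` [set 0]).
    exact: closed_openC (@accessible_closed_set1 _ (@hausdorff_accessible _
      (@Rhausdorff R)) 0).
  by apply/seteqP; split => x /= /eqP.
apply/measurable_funU => //; first exact: open_measurable.
split.
  apply: open_continuous_measurable_fun => // x; rewrite inE /= => x0.
  exact: inv_continuous.
move=> _ B mB; have [B0|B0] := pselect (B (0^-1)).
  rewrite (_ : _ `&` _ = [set 0]) //.
  by apply/seteqP; split => x /= => [[]|->].
rewrite (_ : _ `&` _ = set0) //.
by apply/seteqP; split => x //= [-> ].
Qed.

Lemma measurable_funV (f : T -> R) :
  measurable_fun setT f -> measurable_fun setT (fun t => (f t)^-1).
Proof. exact: measurableT_comp measurable_inv_real. Qed.

Lemma measurable_mx_coord p q (f : T -> borel 'M[R]_(p, q)) i j :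
  measurable_fun setT f -> measurable_fun setT (fun t =>
    (f t : 'M[R]_(p, q)) i j).
Proof. exact: measurableT_comp (measurable_coord i j). Qed.

Lemma measurable_mulmx p q r (f : T -> borel 'M[R]_(p,
  q)) (g : T -> borel 'M[R]_(q, r)) :
  measurable_fun setT f -> measurable_fun setT g ->
  measurable_fun setT ((fun t => (f t : 'M[R]_(p,
    q)) *m g t) : T -> borel 'M[R]_(p, r)).
Proof.
move=> mf mg; apply: measurable_mx => i j.
apply: eq_measurable_fun (_ : measurable_fun _ (fun t =>
  \sum_k (f t : 'M[R]_(p, q)) i k * (g t : 'M[R]_(q, r)) k j)) => [t _|].
  by rewrite mxE.
by apply: measurable_sum => k; apply: measurable_funM;
  exact: measurable_mx_coord.
Qed.

Lemma measurable_addmx p q (f g : T -> borel 'M[R]_(p, q)) :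
  measurable_fun setT f -> measurable_fun setT g ->
  measurable_fun setT ((fun t => (f t : 'M[R]_(p,
    q)) + g t) : T -> borel 'M[R]_(p, q)).
Proof.
move=> mf mg; apply: measurable_mx => i j.
apply: eq_measurable_fun (_ : measurable_fun _ (fun t =>
  (f t : 'M[R]_(p, q)) i j + (g t : 'M[R]_(p, q)) i j)) => [t _|].
  by rewrite mxE.
by apply: measurable_funD; exact: measurable_mx_coord.
Qed.

Lemma measurable_scalemx p q (a : T -> R) (f : T -> borel 'M[R]_(p, q)) :
  measurable_fun setT a -> measurable_fun setT f ->
  measurable_fun setT ((fun t => a t *: (f t : 'M[R]_(p,
    q))) : T -> borel 'M[R]_(p, q)).
Proof.
move=> ma mf; apply: measurable_mx => i j.
apply: eq_measurable_fun (_ : measurable_fun _ (fun t =>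
  a t * (f t : 'M[R]_(p, q)) i j)) => [t _|].
  by rewrite mxE.
by apply: measurable_funM => //; exact: measurable_mx_coord.
Qed.

Lemma measurable_subrmx p q (f g : T -> borel 'M[R]_(p, q)) :
  measurable_fun setT f -> measurable_fun setT g ->
  measurable_fun setT ((fun t => (f t : 'M[R]_(p,
    q)) - g t) : T -> borel 'M[R]_(p, q)).
Proof.
move=> mf mg; apply: measurable_mx => i j.
apply: eq_measurable_fun (_ : measurable_fun _ (fun t =>
  (f t : 'M[R]_(p, q)) i j - (g t : 'M[R]_(p, q)) i j)) => [t _|].
  by rewrite !mxE.
by apply: measurable_funB; exact: measurable_mx_coord.
Qed.

Lemma measurable_trmx p q (f : T -> borel 'M[R]_(p, q)) :
  measurable_fun setT f ->
  measurable_fun setT ((fun t => (f t : 'M[R]_(p,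
    q))^T) : T -> borel 'M[R]_(q, p)).
Proof.
move=> mf; apply: measurable_mx => i j.
apply: eq_measurable_fun (_ : measurable_fun _ (fun t =>
  (f t : 'M[R]_(p, q)) j i)) => [t _|].
  by rewrite mxE.
exact: measurable_mx_coord.
Qed.

Lemma measurable_dotp d (f g : T -> borel 'rV[R]_d) :
  measurable_fun setT f -> measurable_fun setT g ->
  measurable_fun setT (fun t => dotp (f t) (g t)).
Proof.
move=> mf mg; apply: (@measurable_mx_coord _ _
  (fun t => (f t : 'rV[R]_d) *m (g t : 'rV[R]_d)^T)).
by apply: measurable_mulmx => //; exact: measurable_trmx.
Qed.

Lemma null_eq (P : probability T R) (A B N : set T) :
  measurable A -> measurable B -> measurable N -> P N = 0%E ->
  (forall w, ~ N w -> (A w <-> B w)) -> P A = P B.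
Proof.
move=> mA mB mN N0 AB.
have h (C : set T) : measurable C -> P C = P (C `\` N).
  move=> mC; rewrite measureD// ?(le_lt_trans (probability_le1 _ _)) ?ltry//.
  rewrite [X in (_ - X)%E](_ : _ = 0%E) ?sube0//.
  apply/eqP; rewrite eq_le measure_ge0 andbT -N0 le_measure ?inE//.
  exact: measurableI.
rewrite h// [RHS]h//; congr (P _).
by apply/seteqP; split => w [/= Cw Nw]; split => //; apply/AB.
Qed.

Lemma null_sub (P : probability T R) (A N : set T) :
  measurable A -> measurable N -> P N = 0%E -> A `<=` N -> P A = 0%E.
Proof.
move=> mA mN N0 AN; apply/eqP; rewrite eq_le measure_ge0 andbT -N0.
by rewrite le_measure ?inE.
Qed.

End MeasurableMatrixOps.

(** * Uniform vectors and uniform subspaces *)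

Section UniformLaws.
Context {R : realType} {d : nat}.
Local Notation E := 'rV[R]_d.
Local Notation MM := 'M[R]_d.

(** The trace form shows the invariance under orthogonal factors: right factors cancel at once, left
    factors after a cyclic permutation. *)
Lemma sqdist_tr p q (x y : 'M[R]_(p,
  q)) : sqdist x y = \tr ((x - y) *m (x - y)^T).
Proof.
rewrite /sqdist /mxtrace; apply: eq_bigr => i _; rewrite mxE.
by apply: eq_bigr => j _; rewrite !mxE expr2.
Qed.

Lemma sphere_law_unique d1 d2 (O1 : measurableType d1) (O2 : measurableType d2)
    (P1 : probability O1 R) (P2 : probability O2 R)
    (X : O1 -> borel E) (Y : O2 -> borel E) :
  measurable_fun setT X -> measurable_fun setT Y ->
  (forall w, dotp (X w : E) (X w) = 1) -> (forall w,
    dotp (Y w : E) (Y w) = 1) ->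
  (forall g : MM, orthogonal_mx g -> forall B : set (borel E), measurable B ->
    P1 [set w | B ((X w : E) *m g)] = P1 [set w | B (X w)]) ->
  (forall g : MM, orthogonal_mx g -> forall B : set (borel E), measurable B ->
    P2 [set w | B ((Y w : E) *m g)] = P2 [set w | B (Y w)]) ->
  forall B : set (borel E), measurable B ->
    P1 [set w | B (X w)] = P2 [set w | B (Y w)].
Proof.
move=> mX mY X1 Y1 iX iY.
apply: (@invariant_law_unique _ _ _ _ _ _ _ P1 P2 X Y [set x : E | dotp x x = 1]
  [set f | exists2 g : MM, orthogonal_mx g & f = fun x => x *m g]) => //.
- move=> _ [g og ->] x y; rewrite !sqdist_tr -mulmxBl trmx_mul mulmxA.
  by rewrite -(mulmxA _ g) og mulmx1.
- move=> x y /= x1 y1; have [|g og <-] := @sphere_transitive _ _ x y.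
    by rewrite x1 y1.
  by exists (fun x => x *m g) => //; exists g.
- by move=> _ [g og ->] B mB; exact: iX.
- by move=> _ [g og ->] B mB; exact: iY.
Qed.

Lemma grassmann_law_unique m d1 d2 (O1 : measurableType d1)
    (O2 : measurableType d2)
    (P1 : probability O1 R) (P2 : probability O2 R)
    (X : O1 -> borel MM) (Y : O2 -> borel MM) :
  measurable_fun setT X -> measurable_fun setT Y ->
  (forall w, exists2 V : {vspace E}, \dim V = m & X w = orth_proj V) ->
  (forall w, exists2 V : {vspace E}, \dim V = m & Y w = orth_proj V) ->
  (forall g : MM, orthogonal_mx g -> forall B : set (borel MM), measurable B ->
    P1 [set w | B (g^T *m (X w : MM) *m g)] = P1 [set w | B (X w)]) ->
  (forall g : MM, orthogonal_mx g -> forall B : set (borel MM), measurable B ->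
    P2 [set w | B (g^T *m (Y w : MM) *m g)] = P2 [set w | B (Y w)]) ->
  forall B : set (borel MM), measurable B ->
    P1 [set w | B (X w)] = P2 [set w | B (Y w)].
Proof.
move=> mX mY X1 Y1 iX iY.
apply: (@invariant_law_unique _ _ _ _ _ _ _ P1 P2 X Y
  [set p : MM | exists2 V : {vspace E}, \dim V = m & p = orth_proj V]
  [set f | exists2 g : MM, orthogonal_mx g & f = fun x => g^T *m x *m g]) => //.
- move=> _ [g og ->] x y; rewrite !sqdist_tr -mulmxBl -mulmxBr !trmx_mul trmxK.
  rewrite -!mulmxA (mulmxA g g^T) og mul1mx mxtrace_mulC.
  by rewrite -!mulmxA og mulmx1.
- move=> _ _ [V Vm ->] [V' V'm ->].
  have [|g og <-] := @grassmannian_transitive _ _ V V'; first by rewrite Vm.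
  by exists (fun x => g^T *m x *m g); [exists g|rewrite orth_proj_rotate].
- by move=> _ [g og ->] B mB; exact: iX.
- by move=> _ [g og ->] B mB; exact: iY.
Qed.

Lemma rotate_fullv (g : MM) : orthogonal_mx g -> rotate g fullv = fullv.
Proof. by move=> og; apply/vspaceP => x; rewrite mem_rotate// !memvf. Qed.

Context {disp : measure_display} {Omega : measurableType disp}.
Context (P : probability Omega R).
Context (W : nat -> Omega -> {vspace E}) (U : Omega -> E).
Hypothesis unifW : forall m, (m <= d)%N -> uniform_subspace P m (W m).
Hypothesis unifU : uniform_on_sphere P fullv U.
Hypothesis d_gt0 : (0 < d)%N.

Lemma measurable_U : measurable_fun setT (U : Omega -> borel E).
Proof. by have [] := unifU. Qed.

Lemma U_unit w : dotp (U w) (U w) = 1.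
Proof. by have [_ /(_ w)[]] := unifU. Qed.

Lemma U_neq0 w : U w != 0.
Proof. by rewrite -dotpp_eq0 U_unit oner_eq0. Qed.

Lemma U_invariant (g : MM) : orthogonal_mx g ->
  forall B : set (borel E), measurable B ->
  P [set w | B (U w *m g)] = P [set w | B (U w)].
Proof. by move=> og; have [_ _] := unifU; apply => //; exact: rotate_fullv. Qed.

Lemma measurable_cst_dotp d' (T : measurableType d') (f : T ->
  borel E) (x : E) :
  measurable_fun setT f -> measurable_fun setT (fun t => dotp (f t) x).
Proof. by move=> mf; apply: (measurable_dotp (g := fun=> x)). Qed.

(* All hyperplanes through the origin have the same probability, and a nonzero
   vector lies in fewer than [d] of those normal to points of the moment curve.
     *)
Lemma hyperplane_null (x : E) : x != 0 -> P [set w | dotp (U w) x = 0] = 0%E.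
Proof.
move=> x0.
have mH (y : E) : measurable [set u : borel E | dotp (u : E) y = 0].
  by apply: measurable_set_eq; exact: measurable_cst_dotp.
have mA (y : E) : measurable [set w | dotp (U w) y = 0].
  exact: (measurable_preim measurable_U (mH y)).
have rot (y : E) : y != 0 -> P [set w | dotp (U w) y = 0] =
  P [set w | dotp (U w) x = 0].
  move=> y0; pose n (z : E) := (Num.sqrt (dotp z z))^-1 *: z.
  have n1 z : z != 0 -> dotp (n z) (n z) = 1.
    move=> z0; rewrite dotpZl dotpZr mulrA -invfM -expr2 sqr_sqrtr ?dotpp_ge0//.
    by rewrite mulVf// dotpp_eq0.
  have nz z : z != 0 -> forall u, (dotp u (n z) = 0) <-> (dotp u z = 0).
    move=> z0 u; rewrite dotpZr; split => [/eqP|->]; last by rewrite mulr0.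
    rewrite mulf_eq0 invr_eq0 sqrtr_eq0 leNgt dotpp_gt0 z0 /= => /eqP //.
  have [|g og gy] := @sphere_transitive _ _ (n y) (n x); first by rewrite !n1.
  rewrite -[RHS](U_invariant og (mH x)); congr (P _); apply/seteqP.
  split => w /=.
    by move=> /(nz _ y0) h; apply/(nz _ x0); rewrite -gy orthogonal_dotp.
  by move=> /(nz _ x0); rewrite -gy orthogonal_dotp// => /(nz _ y0).
pose c (i : nat) : E := \row_(j < d) (i%:R ^+ j).
have c0 i : c i != 0.
  apply/eqP => /rowP/(_ (Ordinal d_gt0)); rewrite !mxE expr0 => /eqP.
  by rewrite oner_eq0.
pose A i := [set w | dotp (U w) (c i) = 0].
(* The events [B n] decrease to the empty set, because a vector in infinitely many [A i] would give
   a nonzero polynomial with infinitely many roots. Hence their probabilities tend to [0], yet each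
   is at least that of [A n], which is the constant to be bounded. *)
pose B n := \bigcup_(i in [set i | (n <= i)%N]) A i.
have mB n : measurable (B n) by apply: bigcup_measurable => i _; exact: mA.
have B0 : \bigcap_n B n = set0.
  apply/seteqP; split => w // hw.
  pose p := rVpoly (U w).
  have pE i : p.[i%:R] = dotp (U w) (c i).
    rewrite dotpE (@horner_coef_wide _ d) ?size_poly//; apply: eq_bigr => j _.
    by rewrite coef_rVpoly_ord mxE.
  have p0 : p != 0.
    apply/eqP => pz; have := U_neq0 w; rewrite -(rVpolyK (U w)) -/p pz.
    by rewrite linear0 eqxx.
  have /choice[f fP] : forall n, exists i, (n <= i)%N /\ root p i%:R.
    move=> n; have [i /= ni Ai] := hw n I; exists i; split => //.
    by apply/rootP; rewrite pE.
  (* A strictly increasing choice of indices, so that the first [size p] roots are distinct, one too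
     many for [max_poly_roots]. *)
  pose s := fix s n := if n is n'.+1 then f (s n').+1 else f 0%N.
  have sm : {homo s : i j / (i < j)%N}.
    apply: homo_ltn => [|i]; first exact: ltn_trans.
    by have [] := fP (s i).+1.
  have si : injective s by apply: (incn_inj (leq_mono sm)).
  have := @max_poly_roots _ p [seq (s i)%:R | i <- iota 0 (size p)] p0.
  rewrite size_map size_iota ltnn => h; suff : false by []; apply: h.
    apply/allP => _ /mapP[i _ ->]; case: i => [|i] /=;
      first by have [] := fP 0%N.
    by have [] := fP (s i).+1.
  rewrite map_inj_uniq ?iota_uniq// => i j /eqP; rewrite eqr_nat => /eqP;
    exact: si.
have cB : P (B n) @[n --> \oo] --> P (\bigcap_n B n).
  apply: nonincreasing_cvg_mu => //.
  - by rewrite (le_lt_trans (probability_le1 _ _)) ?ltry.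
  - by rewrite B0; exact: measurable0.
  - move=> m n mn; apply/subsetPset => w [i /= ni Ai]; exists i => //=.
    exact: leq_trans ni.
rewrite B0 measure0 in cB.
apply/eqP; rewrite eq_le measure_ge0 andbT.
rewrite -(cvg_lim (@ereal_hausdorff R) cB); apply: lime_ge.
  by apply/cvg_ex; eexists; exact: cB.
exists 0%N => // n _; rewrite -(rot (c n))//; apply: le_measure; rewrite ?inE//.
by move=> w Aw; exists n => //=.
Qed.

Definition pW m w : borel MM := orth_proj (W m w).

Lemma measurable_pW m : (m <= d)%N -> measurable_fun setT (pW m).
Proof. by move=> /unifW[]. Qed.

Lemma dim_W m w : (m <= d)%N -> \dim (W m w) = m.
Proof. by move=> /unifW[_ /(_ w)]. Qed.

Lemma W_invariant m (g : MM) : (m <= d)%N -> orthogonal_mx g ->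
  forall B : set (borel MM), measurable B ->
  P [set w | B (g^T *m (pW m w : MM) *m g)] = P [set w | B (pW m w)].
Proof.
move=> md og B mB; have [_ _ /(_ g og B mB) <-] := unifW md.
by congr (P _); apply/seteqP; split => w /=; rewrite orth_proj_rotate.
Qed.

Lemma measurable_pWU m : (m <= d)%N ->
  measurable_fun setT (fun w : Omega * Omega => (pW m w.1, U w.2 : borel E)).
Proof.
move=> md; apply: measurable_fun_pair.
  exact: measurableT_comp (measurable_pW md) measurable_fst.
exact: measurableT_comp measurable_U measurable_snd.
Qed.

(** On the product both coordinates can be rotated by the same [g]. Any function of the pair that
    commutes with rotations therefore has an invariant law. *)
Lemma joint_invariant m (g : MM) : (m <= d)%N -> orthogonal_mx g ->
  forall C : set (borel MM * borel E), measurable C ->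
  (P \x P)%E [set w | C (g^T *m (pW m w.1 : MM) *m g, U w.2 *m g)] =
  (P \x P)%E [set w | C (pW m w.1, U w.2)].
Proof.
move=> md og C mC.
apply: (@prod_law _ _ _ _ _ _ _ _ _ _ _ P P (P \x P)%E (pW m) (U : Omega ->
  borel E)
  (fun w => (g^T *m (pW m w.1 : MM) *m g, U w.2 *m g))) => //.
- exact: measurable_pW.
- exact: measurable_U.
- apply: measurable_fun_pair.
    apply: measurable_mulmx => //; apply: measurable_mulmx => //.
    exact: measurableT_comp (measurable_pW md) measurable_fst.
  apply: measurable_mulmx => //.
  exact: measurableT_comp measurable_U measurable_snd.
move=> S T mS mT.
rewrite -(W_invariant md og mS) -(U_invariant og mT).
apply: (product_measure1E P P (A1 := [set w | S (g^T *m (pW m w : MM) *m g)])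
  (A2 := [set w | T (U w *m g)])).
- apply: (@measurable_preim _ _ _ _ (fun w =>
    g^T *m (pW m w : MM) *m g : borel MM)) => //.
  by apply: measurable_mulmx => //; apply: measurable_mulmx => //;
    exact: measurable_pW.
- apply: (@measurable_preim _ _ _ _ (fun w => U w *m g : borel E)) => //.
  by apply: measurable_mulmx => //; exact: measurable_U.
Qed.

Definition residual (p : MM) (u : E) : E := u - u *m p.

(** The formula of [orth_proj_add], extended to arbitrary matrices so that it is a measurable
    function on the whole Borel space. *)
Definition add_line (p : MM) (u : E) : MM :=
  p + (dotp (residual p u) (residual p u))^-1 *: ((residual p u)^T *m
    residual p u).

Lemma residual_rotate (g p : MM) u : orthogonal_mx g ->
  residual (g^T *m p *m g) (u *m g) = residual p u *m g.
Proof.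
move=> og; rewrite /residual mulmxBl; congr (_ - _).
by rewrite !mulmxA -(mulmxA u) og mulmx1.
Qed.

Lemma add_line_rotate (g p : MM) u : orthogonal_mx g ->
  add_line (g^T *m p *m g) (u *m g) = g^T *m add_line p u *m g.
Proof.
move=> og; rewrite /add_line residual_rotate// orthogonal_dotp// trmx_mul.
by rewrite mulmxDr mulmxDl -scalemxAr -scalemxAl !mulmxA.
Qed.

Lemma residual_eq0 V u : (residual (orth_proj V) u == 0) = (u \in V).
Proof. by rewrite subr_eq0 orth_projP eq_sym. Qed.

Lemma measurable_residual d' (T : measurableType d') (f : T ->
  borel MM) (u : T -> borel E) :
  measurable_fun setT f -> measurable_fun setT u ->
  measurable_fun setT (fun t => residual (f t) (u t) : borel E).
Proof. by move=> mf mu; apply: measurable_subrmx => //;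
  apply: measurable_mulmx. Qed.

Lemma measurable_add_line d' (T : measurableType d') (f : T ->
  borel MM) (u : T -> borel E) :
  measurable_fun setT f -> measurable_fun setT u ->
  measurable_fun setT (fun t => add_line (f t) (u t) : borel MM).
Proof.
move=> mf mu; have mr := measurable_residual mf mu.
apply: measurable_addmx => //; apply: measurable_scalemx.
  by apply: measurable_funV; exact: measurable_dotp.
by apply: measurable_mulmx => //; exact: measurable_trmx.
Qed.

Lemma mem_subspace_null V : (\dim V < d)%N ->
  exists N, [/\ measurable N, P N = 0%E & [set w | U w \in V] `<=` N].
Proof.
move=> /exists_normal[x x0 xV]; exists [set w | dotp (U w) x = 0]; split.
- by apply: measurable_set_eq; apply: measurable_cst_dotp; exact: measurable_U.
- exact: hyperplane_null.
- by move=> w /= /xV.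
Qed.

Lemma residual_null m : (m < d)%N ->
  measurable [set w : Omega * Omega | residual (pW m w.1) (U w.2) = 0] /\
  (P \x P)%E [set w | residual (pW m w.1) (U w.2) = 0] = 0%E.
Proof.
move=> md.
have mN : measurable [set w : Omega * Omega | residual (pW m w.1) (U w.2) = 0].
  rewrite (_ : mkset _ = [set w | dotp (residual (pW m w.1) (U w.2)) (residual
    (pW m w.1) (U w.2)) = 0]).
    have mr : measurable_fun setT (fun w : Omega * Omega =>
      residual (pW m w.1) (U w.2) : borel E).
      apply: measurable_residual.
        exact: measurableT_comp (measurable_pW (ltnW md)) measurable_fst.
      exact: measurableT_comp measurable_U measurable_snd.
    by apply: measurable_set_eq; exact: measurable_dotp.
  by apply/seteqP; split => w /= /eqP h; apply/eqP; move: h; rewrite dotpp_eq0.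
split => //; apply: (@product_null _ _ _ _ _ _ _ _ set0) => // w _.
have Wd : (\dim (W m w) < d)%N by rewrite dim_W// ltnW.
have [N [mN' N0 NU]] := mem_subspace_null Wd.
apply: (null_sub (N := N)) => //; first exact: measurable_xsection.
move=> y; rewrite /xsection /= inE /= => /eqP; rewrite residual_eq0; exact: NU.
Qed.

Lemma law_succ m : (m < d)%N -> forall B : set (borel MM), measurable B ->
  P [set w | B (pW m.+1 w)] =
  (P \x P)%E [set w | B (add_line (pW m w.1) (U w.2))].
Proof.
move=> md.
have [mN N0] := residual_null md.
set N := mkset _ in mN N0.
(* On the null event that [U] falls in [W m], the sum has the wrong dimension. [Y] takes the value
   [pW m.+1] there, so that all its values are projections of rank [m.+1], as [grassmann_law_unique]
   demands; its invariance is inherited from [add_line] by almost sure equality. *)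
pose Y (w : Omega * Omega) : borel MM :=
  if residual (pW m w.1) (U w.2) == 0 then pW m.+1 w.1 else add_line (pW m w.1)
    (U w.2).
have mA : measurable_fun setT (fun w : Omega * Omega =>
  add_line (pW m w.1) (U w.2) : borel MM).
  apply: measurable_add_line.
    exact: measurableT_comp (measurable_pW (ltnW md)) measurable_fst.
  exact: measurableT_comp measurable_U measurable_snd.
have mY : measurable_fun setT Y.
  apply: measurable_fun_ifT => //.
    apply: (@measurable_fun_bool _ _ _ _ true); rewrite setTI.
    rewrite (_ : _ @^-1` _ = N)//.
    by apply/seteqP; split => w /= /eqP.
  exact: measurableT_comp (measurable_pW md) measurable_fst.
have YA (w : Omega * Omega) : ~ N w -> Y w = add_line (pW m w.1) (U w.2).
  by rewrite /N /= /Y => /eqP/negbTE ->.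
have lawY (B : set (borel MM)) : measurable B ->
    (P \x P)%E [set w | B (Y w)] = (P \x P)%E [set w | B (add_line (pW m w.1)
      (U w.2))].
  move=> mB; apply: (null_eq _ _ mN N0).
  - exact: (measurable_preim mY).
  - exact: (measurable_preim mA).
  - by move=> w /YA e /=; rewrite e.
move=> B mB; rewrite -lawY//.
apply: (@grassmann_law_unique m.+1 _ _ _ _ P (P \x P)%E (pW m.+1) Y) => //.
- exact: measurable_pW.
- by move=> w; exists (W m.+1 w) => //; exact: dim_W.
- move=> w; rewrite /Y; case: ifPn => [_|];
    first by exists (W m.+1 w.1) => //; exact: dim_W.
  rewrite residual_eq0 => UW; exists (W m w.1 + <[U w.2]>)%VS.
    by rewrite dim_add_line// dim_W// ltnW.
  by rewrite orth_proj_add.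
- by move=> g og C mC; exact: W_invariant.
move=> g og C mC.
have mg : measurable_fun setT (fun x : borel MM =>
  g^T *m (x : MM) *m g : borel MM).
  by apply: measurable_mulmx => //; apply: measurable_mulmx.
have e := lawY _ (measurable_preim mg mC).
rewrite [RHS]lawY//; apply: (etrans e) => {e}.
have mC' : measurable [set pu : borel MM * borel E | C (add_line pu.1 pu.2)].
  apply: (@measurable_preim _ _ _ _ (fun pu : borel MM * borel E =>
    add_line pu.1 pu.2 : borel MM)) => //.
  by apply: measurable_add_line; [exact: measurable_fst|exact: measurable_snd].
rewrite -(joint_invariant (ltnW md) og mC'); congr ((P \x P)%E _).
by apply/seteqP; split => w /=; rewrite add_line_rotate.
Qed.

End UniformLaws.

(** * Measurability of the event that a cone meets a half-subspace *)

Section CompactMeets.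
Context {R : realType} {d : nat}.
Local Notation E := 'rV[R]_d.
Local Notation MM := 'M[R]_d.

Lemma continuous_affine n (v : E) (A : 'M[R]_(d, n)) j :
  continuous (fun x : E => ((x - v) *m A) 0 j).
Proof.
rewrite (_ : (fun x => _) = (fun x : E => \sum_i (x 0 i - v 0 i) * A i j)).
  apply: continuous_sumr => i x; apply: (continuousM (s := fun x : E =>
    x 0 i - v 0 i) (t := fun=> A i j)); last exact: cst_continuous.
  by apply: (@continuousB _ R^o);
    [exact: coord_continuous|exact: cst_continuous].
by apply/funext => x; rewrite mxE; apply: eq_bigr => i _; rewrite !mxE.
Qed.

Lemma continuous_dotp_affine (v : E) (A B : MM) :
  continuous (fun x : E => dotp ((x - v) *m A) ((x - v) *m B)).
Proof.
rewrite (_ : (fun x => _) = (fun x : E =>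
  \sum_i ((x - v) *m A) 0 i * ((x - v) *m B) 0 i)).
  by apply: continuous_sumr => i x;
    apply: (continuousM (s := fun x : E =>
    ((x - v) *m A) 0 i) (t := fun x : E => ((x - v) *m B) 0 i));
    exact: continuous_affine.
by apply/funext => x; rewrite dotpE.
Qed.

Lemma continuous_dotpl (v u : E) : continuous (fun x : E => dotp (x - v) u).
Proof. exact: continuous_affine. Qed.

Lemma continuous_sqnorm (v : E) : continuous (fun x : E =>
  dotp (x - v) (x - v)).
Proof.
have := @continuous_dotp_affine v 1%:M 1%:M.
by rewrite (_ : (fun x => _) = (fun x : E => dotp (x - v) (x - v)))//;
  apply/funext => x; rewrite !mulmx1.
Qed.

Lemma compact_meets_measurable disp (T : measurableType disp)
    (f : T -> borel MM) (u : T -> borel E) (K : set E) (v : E) (c : R) :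
  compact K -> measurable_fun setT f -> measurable_fun setT u ->
  measurable [set t | exists2 x, K x &
    (x - v) *m (f t : MM) = x - v /\ c <= dotp (x - v) (u t)].
Proof.
move=> cK mf mu.
(* Both summands are nonnegative, so [F t x <= 0] forces each to vanish: the first encodes the
   equation, the second, of the form [|a| - a], the inequality. *)
pose F (t : T) (x : E) : R :=
  dotp ((x - v) *m ((f t : MM) - 1%:M)) ((x - v) *m ((f t : MM) - 1%:M)) +
  (`|dotp (x - v) (u t) - c| - (dotp (x - v) (u t) - c)).
rewrite (_ : mkset _ = [set t | exists2 x, K x & F t x <= 0]).
  apply: (compact_exists_measurable cK) => [x|t].
    apply: measurable_funD.
      apply: measurable_dotp; apply: measurable_mulmx => //;
        exact: measurable_subrmx.
    have ma : measurable_fun setT (fun t => dotp (x - v) (u t) - c).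
      by apply: measurable_funB => //;
        apply: (measurable_dotp (f := fun=> x - v)).
    by apply: measurable_funB => //; exact: measurableT_comp.
  have ca : continuous (fun x : E => dotp (x - v) (u t) - c).
    by move=> x; apply: (continuousB (f := fun x : E =>
      dotp (x - v) (u t)) (g := fun=> c));
      [exact: continuous_dotpl|exact: cst_continuous].
  move=> x; apply: (continuousD (f := fun x : E =>
    dotp ((x - v) *m ((f t : MM) - 1%:M)) ((x - v) *m ((f t : MM) - 1%:M)))
    (g := fun x : E => `|dotp (x - v) (u t) - c| - (dotp (x - v) (u t) - c)));
      first exact: continuous_dotp_affine.
  apply: (continuousB (f := fun x : E => `|dotp (x - v) (u t) - c|));
    last exact: ca.
  by apply: continuous_comp; [exact: ca|exact: norm_continuous].
apply/seteqP; split => t /= [x Kx].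
  move=> [e ge]; exists x => //.
  by rewrite /F mulmxBr mulmx1 e subrr dot0p add0r ger0_norm ?subrr// subr_ge0.
move=> F0; exists x => //.
have h1 := dotpp_ge0 ((x - v) *m ((f t : MM) - 1%:M)).
have h2 : 0 <= `|dotp (x - v) (u t) - c| - (dotp (x - v) (u t) - c).
  by rewrite subr_ge0 ler_norm.
split.
  have /eqP : dotp ((x - v) *m ((f t : MM) - 1%:M)) ((x - v) *m
    ((f t : MM) - 1%:M)) = 0.
    by apply/eqP; rewrite eq_le h1 andbT; move: F0; rewrite /F; lra.
  by rewrite dotpp_eq0 mulmxBr mulmx1 subr_eq0 => /eqP.
have h3 : `|dotp (x - v) (u t) - c| <= dotp (x - v) (u t) - c.
  by move: F0; rewrite /F; lra.
by rewrite -subr_ge0 (le_trans _ h3).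
Qed.

(** The angle event in terms of points of [Q] instead of vectors of its tangent cone. A matrix [p]
    stands for the projection onto the subspace, so that the condition makes sense on the whole
    Borel space of matrices. *)
Definition cone_meets (Q : set E) (v : E) (p : MM) (u : E) : Prop :=
  exists2 x, Q x & [/\ x != v, (x - v) *m p = x - v & 0 <= dotp (x - v) u].

Lemma cone_meets_measurable disp (T : measurableType disp)
    (f : T -> borel MM) (u : T -> borel E) (Q : set E) (v : E) :
  compact Q -> measurable_fun setT f -> measurable_fun setT u ->
  measurable [set t | cone_meets Q v (f t) (u t)].
Proof.
move=> cQ mf mu.
(* The condition [x != v] is not closed; [Q] without [v] is exhausted by the compact sets [K n]. *)
pose K n := Q `&` [set x | n.+1%:R^-1 <= dotp (x - v) (x - v)].
rewrite (_ : mkset _ = \bigcup_n [set t | exists2 x, K n x &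
    (x - v) *m (f t : MM) = x - v /\ 0 <= dotp (x - v) (u t)]).
  apply: bigcupT_measurable => n; apply: compact_meets_measurable => //.
  apply: compact_closedI => //.
  apply: (@closed_comp _ _ (fun x : E =>
    dotp (x - v) (x - v)) [set r | n.+1%:R^-1 <= r]).
    by move=> x _; exact: continuous_sqnorm.
  exact: closed_ge.
apply/seteqP; split => t /=.
  move=> [x Qx [xv xf xu]].
  have x0 : 0 < dotp (x - v) (x - v) by rewrite dotpp_gt0 subr_eq0.
  have [n /(_ n (leqnn n)) nx] := natSinv_lt x0.
  by exists n => //; exists x => //; split => //=; exact: ltW.
move=> [n _ [x [Qx /= nx] [xf xu]]]; exists x => //; split => //.
rewrite -subr_eq0 -dotpp_gt0; apply: lt_le_trans nx.
by rewrite invr_gt0.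
Qed.

Definition unit_sphere (L : {vspace E}) : set E := [set x | x \in L /\ dotp x x
  = 1].

Lemma norm_le_dotp (x : E) (c : R) : 0 < c -> dotp x x < c ^+ 2 -> `|x| < c.
Proof.
move=> c0 xc; have : ball (0 : E) c x.
  apply/mx_ballP; split => // i j; rewrite mxE sub0r normrN (ord1 i).
  rewrite -(ltr_pXn2r (ltn0Sn 1)) ?nnegrE ?(ltW c0)// real_normK ?num_real//.
  apply: le_lt_trans xc; rewrite dotpE (bigD1 j)//= -expr2 lerDl.
  by apply: sumr_ge0 => k _; rewrite -expr2 sqr_ge0.
by rewrite -ball_normE /= sub0r normrN.
Qed.

Lemma compact_unit_sphere L : compact (unit_sphere L).
Proof.
apply: bounded_closed_compact.
  exists 2; split => //= M M2 x [_ x1]; apply: ltW.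
  by apply: lt_trans M2; apply: norm_le_dotp; rewrite // x1; lra.
have -> : unit_sphere L =
    [set x | dotp ((x - 0) *m (orth_proj L - 1%:M)) ((x - 0) *m
      (orth_proj L - 1%:M)) = 0] `&`
    [set x | dotp (x - 0) (x - 0) = 1].
  apply/seteqP; split => x /=; rewrite subr0 => -[xL x1]; split => //.
    by rewrite mulmxBr mulmx1 orth_proj_id// subrr dot0p.
  by move/eqP: xL; rewrite dotpp_eq0 mulmxBr mulmx1 subr_eq0 -orth_projP.
apply: closedI.
  apply: (@closed_comp _ _ (fun x : E => dotp ((x - 0) *m (orth_proj L - 1%:M))
    ((x - 0) *m (orth_proj L - 1%:M))) [set 0]).
    by move=> x _; exact: continuous_dotp_affine.
  exact: closed_eq.
apply: (@closed_comp _ _ (fun x : E => dotp (x - 0) (x - 0)) [set 1]).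
  by move=> x _; exact: continuous_sqnorm.
exact: closed_eq.
Qed.

End CompactMeets.

(** * General position and the coupling of consecutive dimensions *)

Section RandomSubspaces.
Context {R : realType} {d : nat}.
Local Notation E := 'rV[R]_d.
Local Notation MM := 'M[R]_d.
Context {disp : measure_display} {Omega : measurableType disp}.
Context (P : probability Omega R).
Context (W : nat -> Omega -> {vspace E}) (U : Omega -> E).
Hypothesis unifW : forall m, (m <= d)%N -> uniform_subspace P m (W m).
Hypothesis unifU : uniform_on_sphere P fullv U.
Hypothesis indepWU : forall m, (m <= d)%N -> independent P (W m) U.
Hypothesis d_gt0 : (0 < d)%N.

Local Notation pW := (pW W).
Let mU : measurable_fun setT (U : Omega -> borel E) := measurable_U unifU.
Let mW m (md : (m <= d)%N) : measurable_fun setT (pW m) := measurable_pW unifW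
  md.

Lemma add_line_orth_proj (V : {vspace E}) u :
  add_line (orth_proj V) u = orth_proj (V + <[u]>)%VS.
Proof. by rewrite orth_proj_add. Qed.

Lemma mul_pW m w x : (x *m (pW m w : MM) = x) <-> x \in W m w.
Proof. by rewrite orth_projP; split => /eqP. Qed.

(** Suppose [W m] meets [L] only at the origin. A nonzero vector [z + a *: U] of [L] with [z] in
    [W m] has [a != 0], so [U] lies in [W m + L], a subspace of dimension at most [m + \dim L < d].
    Intersecting with the unit sphere of [L] keeps the event measurable by compactness. *)
Lemma generic_disjoint m (L : {vspace E}) : (m <= d)%N -> (m + \dim L <= d)%N ->
  measurable [set w | exists2 x, unit_sphere L x & x *m (pW m w : MM) = x] /\
  P [set w | exists2 x, unit_sphere L x & x *m (pW m w : MM) = x] = 0%E.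
Proof.
pose A (p : borel MM) := exists2 x, unit_sphere L x & x *m (p : MM) = x.
have mA : measurable [set p | A p].
  have := @compact_meets_measurable R d _ (borel MM) id (fun=> 0 : borel E)
    (unit_sphere L)
    0 0 (@compact_unit_sphere _ _ L).
  move=> /(_ _ _)-/(_ (@measurable_id _ _ _)) h.
  rewrite (_ : mkset _ = [set t : borel MM | exists2 x : E, unit_sphere L x &
    (x - 0) *m (t : MM) = x - 0 /\ 0 <= dotp (x - 0) 0]); first exact: h.
  apply/seteqP; split => p /= [x Lx]; last by rewrite subr0 => -[e _]; exists x.
  by move=> e; exists x => //; rewrite subr0 dotp0.
have mAW k : (k <= d)%N -> measurable [set w | A (pW k w)].
  by move=> kd; apply: (measurable_preim (mW kd) mA).
move=> md mL; split; first exact: (mAW m md).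
elim: m md mL => [|m IH] md mL.
  rewrite -[RHS](measure0 P); congr (P _); apply/seteqP;
    split => w // [x [_ x1]] /mul_pW.
  have : W 0 w = 0%VS by apply/eqP; rewrite -dimv_eq0 (dim_W unifW).
  move=> ->; rewrite memv0 => /eqP x0.
  by move: x1; rewrite x0 dot0p => /esym/eqP; rewrite oner_eq0.
rewrite (law_succ unifW unifU d_gt0 md mA).
apply: (product_null (N := [set w | A (pW m w)])).
- apply: (@measurable_preim _ _ _ _
    (fun w : Omega * Omega => add_line (pW m w.1) (U w.2) : borel MM)) => //.
  apply: measurable_add_line.
    exact: measurableT_comp (mW (ltnW md)) measurable_fst.
  exact: measurableT_comp mU measurable_snd.
- exact: (mAW _ (ltnW md)).
- by apply: IH; [exact: ltnW|rewrite (leq_trans _ mL)// leq_add2r].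
move=> w nAw.
have [|N [mN N0 NU]] := @mem_subspace_null _ _ _ _ _ _ unifU d_gt0 (W m w +
  L)%VS.
  apply: leq_ltn_trans (dimv_add_leqif _ _) _.
  by rewrite (dim_W unifW) ?(ltnW md)//; rewrite addSn in mL.
apply: (null_sub _ mN N0).
  apply: measurable_xsection; apply: (@measurable_preim _ _ _ _
    (fun w : Omega * Omega => add_line (pW m w.1) (U w.2) : borel MM)) => //.
  apply: measurable_add_line.
    exact: measurableT_comp (mW (ltnW md)) measurable_fst.
  exact: measurableT_comp mU measurable_snd.
move=> y; rewrite /xsection /= inE /= => -[x [xL x1]].
rewrite /pW add_line_orth_proj => /eqP; rewrite -orth_projP.
move=> /memv_addP[z zW [_ /vlineP[a ->] xE]]; apply: NU => /=.
have [a0|a0] := eqVneq a 0.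
  exfalso; apply: nAw; exists x; first by split.
  by apply/mul_pW; rewrite xE a0 scale0r addr0.
have -> : U y = - (a^-1 *: z) + a^-1 *: x.
  by rewrite xE scalerDr addKr scalerA mulVf// scale1r.
by apply: memv_add; rewrite ?rpredN memvZ.
Qed.

(** Transfers events about [(W m, U)] to the product space, where sections are available. *)
Lemma independent_law m (C : set (borel MM * borel E)) : (m <= d)%N ->
  measurable C ->
  P [set w | C (pW m w, U w)] = (P \x P)%E [set w | C (pW m w.1, U w.2)].
Proof.
move=> md mC.
apply: (@prod_law _ _ _ _ _ _ _ _ _ _ _ P P P (pW m) (U : Omega -> borel E)
  (fun w => (pW m w, U w))) => //.
- exact: mW.
- by apply: measurable_fun_pair => //; exact: mW.
by move=> S T mS mT; exact: (indepWU md mS mT).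
Qed.

Lemma measurable_meets_pair (Q : set E) v : compact Q ->
  measurable [set pu : borel MM * borel E | cone_meets Q v pu.1 pu.2].
Proof.
by move=> cQ; exact: cone_meets_measurable.
Qed.

Lemma measurable_meets_W m (Q : set E) v : (m <= d)%N -> compact Q ->
  measurable [set w | cone_meets Q v (pW m w) (U w)].
Proof. by move=> md cQ; apply: cone_meets_measurable => //; exact: mW. Qed.

(** The half-space is frozen first, by integrating over [U] last. For a fixed [u], [law_succ]
    replaces [W m.+1] by [W m] plus the line of a fresh vector, and whatever meets [W m] also meets
    the larger subspace. *)
Lemma meets_succ_le m (Q : set E) v : (m < d)%N -> compact Q ->
  (P [set w | cone_meets Q v (pW m w) (U w)] <=
   P [set w | cone_meets Q v (pW m.+1 w) (U w)])%E.
Proof.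
move=> md cQ; have mC := measurable_meets_pair v cQ.
have mD k : (k <= d)%N -> measurable [set w : Omega * Omega | cone_meets Q v
  (pW k w.1) (U w.2)].
  move=> kd; apply: cone_meets_measurable => //.
    exact: measurableT_comp (mW kd) measurable_fst.
  exact: measurableT_comp mU measurable_snd.
rewrite (independent_law (ltnW md) mC) (independent_law md mC).
rewrite product_measure_swap; last exact: mD (ltnW md).
rewrite product_measure_swap; last exact: mD.
apply: ge0_le_integral => //.
- by apply: measurable_fun_ysection; exact: mD (ltnW md).
- by apply: measurable_fun_ysection; exact: mD.
move=> y _; set u := U y.
have mB : measurable [set p : borel MM | cone_meets Q v p u] by exact:
  cone_meets_measurable.
rewrite [leLHS](_ : _ = P [set w | cone_meets Q v (pW m w) u]); last first.
  by congr (P _); apply/seteqP; split => w; rewrite /ysection /= inE.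
rewrite [leRHS](_ : _ = P [set w | cone_meets Q v (pW m.+1 w) u]); last first.
  by congr (P _); apply/seteqP; split => w; rewrite /ysection /= inE.
have -> := law_succ unifW unifU d_gt0 md mB.
have mBW : measurable [set w | cone_meets Q v (pW m w) u].
  exact: (measurable_preim (mW (ltnW md)) mB).
rewrite -[leLHS]mule1 -(probability_setT P) -product_measure1E//.
apply: le_measure; rewrite ?inE.
- exact: measurableX.
- apply: (@measurable_preim _ _ _ _
    (fun w : Omega * Omega => add_line (pW m w.1) (U w.2) : borel MM)) => //.
  apply: measurable_add_line.
    exact: measurableT_comp (mW (ltnW md)) measurable_fst.
  exact: measurableT_comp mU measurable_snd.
move=> w /= [[x Qx [xv xW xu]] _]; exists x => //; split => //.
rewrite /pW add_line_orth_proj; apply/eqP; rewrite -orth_projP.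
by apply: (subvP (addvSl _ _)); apply/mul_pW.
Qed.

(* For a fixed value of [W m], the exceptional event forces [U] to be orthogonal
   to some fixed nonzero vector. *)
Lemma symmetric_null m (S : set E) : (m <= d)%N -> compact S ->
  (forall x, S x -> S (- x)) ->
  exists N, [/\ measurable N, P N = 0%E &
    forall w, ~ N w -> forall x, S x -> x != 0 -> x \in W m w ->
      exists y, [/\ S y, y \in W m w & 0 < dotp y (U w)]].
Proof.
move=> md cS symS.
pose A := [set pu : borel MM * borel E | cone_meets S 0 pu.1 pu.2].
have mA : measurable A := measurable_meets_pair 0 cS.
pose B := [set pu : borel MM * borel E | exists2 x,
  S x & x *m (pu.1 : MM) = x /\ 0 < dotp x pu.2].
have mB : measurable B.
  (* The strict inequality is a countable union of the closed conditions with bounds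
     [n.+1%:R^-1]. *)
  rewrite (_ : B = \bigcup_n [set pu : borel MM * borel E | exists2 x, S x &
    (x - 0) *m (pu.1 : MM) = x - 0 /\ n.+1%:R^-1 <= dotp (x - 0) pu.2]).
    apply: bigcupT_measurable => n; exact: compact_meets_measurable.
  apply/seteqP; split => pu /=.
    move=> [x Sx [xp xu]]; have [n /(_ n (leqnn n)) nx] := natSinv_lt xu.
    by exists n => //; exists x => //; rewrite subr0; split => //; exact: ltW.
  move=> [n _ [x Sx]]; rewrite subr0 => -[xp nx]; exists x => //; split => //.
  by apply: lt_le_trans nx; rewrite invr_gt0.
pose C := A `\` B.
have mC : measurable C by exact: measurableD.
exists [set w | C (pW m w, U w)]; split.
- apply: (@measurable_preim _ _ _ _ (fun w => (pW m w, U w : borel E))) => //.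
  by apply: measurable_fun_pair => //; exact: mW.
- rewrite (independent_law md mC); apply: (product_null (N := set0)) => //.
    apply: (@measurable_preim _ _ _ _ (fun w : Omega * Omega =>
      (pW m w.1, U w.2 : borel E))) => //.
    exact: (measurable_pWU unifW unifU md).
  move=> w _.
  have mx : measurable (xsection [set w : Omega * Omega | C (pW m w.1,
    U w.2)] w).
    apply: measurable_xsection.
    apply: (@measurable_preim _ _ _ _ (fun w : Omega * Omega =>
      (pW m w.1, U w.2 : borel E))) => //.
    exact: (measurable_pWU unifW unifU md).
  have [[x [Sx x0 xW]]|noX] := pselect (exists x, [/\ S x,
    x != 0 & x \in W m w]); last first.
    rewrite -[RHS](measure0 P); congr (P _); apply/seteqP; split => y //.
    rewrite /xsection /= inE /= => -[[x Sx]];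
      rewrite subr0 /= => -[x0 /mul_pW xW _] _.
    by apply: noX; exists x.
  apply: (null_sub (N := [set y | dotp (U y) x = 0])) => //.
  + by apply: measurable_set_eq; exact: measurable_cst_dotp.
  + exact: hyperplane_null.
  move=> y; rewrite /xsection /= inE /= => -[_ nB]; rewrite dotpC.
  apply/eqP; rewrite eq_le !leNgt; apply/andP; split; apply/negP => h;
    apply: nB.
    by exists x => //; split => //; apply/mul_pW.
  exists (- x); first exact: symS.
  by rewrite /= mulNmx dotpNl oppr_gt0; split => //; congr (- _); apply/mul_pW.
move=> w nC x Sx x0 xW.
apply: contrapT => noY; apply: nC; split.
  have [xu|xu] := leP 0 (dotp x (U w)).
    by exists x => //=; rewrite subr0; split => //; apply/mul_pW.
  exists (- x); first exact: symS.
  rewrite /= subr0 oppr_eq0 dotpNl oppr_ge0 (ltW xu); split => //.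
  by rewrite mulNmx; congr (- _); apply/mul_pW.
move=> [y /= Sy [/mul_pW yW yu]]; apply: noY; exists y; split => //.
Qed.

End RandomSubspaces.

(** * Lattice polytopes *)

Section Polytopes.
Context {R : realType} {d : nat}.
Local Notation E := 'rV[R]_d.
Implicit Types (Q : set E) (x y z u v : E) (V : {vspace E}).

Definition is_convex Q := forall x y (t : R), Q x -> Q y -> 0 <= t <= 1 ->
  Q ((1 - t) *: x + t *: y).

Lemma continuous_mx (T : topologicalType) p q (f : T -> 'M[R]_(p, q)) :
  (forall i j, continuous (fun t => f t i j)) -> continuous f.
Proof.
move=> cf t; apply/cvg_ballP => e e0.
have h (ij : 'I_p * 'I_q) : \forall s \near t,
  `|f t ij.1 ij.2 - f s ij.1 ij.2| < e.
  have /cvgrPdist_lt := cf ij.1 ij.2 t; exact.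
have : \forall s \near t, forall ij : 'I_p * 'I_q,
  `|f t ij.1 ij.2 - f s ij.1 ij.2| < e.
  exact: filter_forall.
apply: filterS => s hs.
by apply/mx_ballP; split => // i j; exact: (hs (i, j)).
Qed.

Lemma conv_hull_convex n (a : 'I_n -> E) : is_convex (conv_hull a).
Proof.
move=> _ _ t [c [c0 c1 ->]] [c' [c0' c1' ->]] /andP[t0 t1].
exists (fun i => (1 - t) * c i + t * c' i); split.
- by move=> i; rewrite addr_ge0// mulr_ge0// subr_ge0.
- by rewrite big_split/= -!mulr_sumr c1 c1' !mulr1 subrK.
- rewrite !scaler_sumr -big_split/=; apply: eq_bigr => i _.
  by rewrite [RHS]scalerDl !scalerA.
Qed.

Lemma conv_hull_vertex n (a : 'I_n -> E) i : conv_hull a (a i).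
Proof.
exists (fun j => (j == i)%:R); split.
- by move=> j; rewrite ler0n.
- by rewrite (bigD1 i)//= eqxx big1 ?addr0// => j /negbTE ->.
- by rewrite (bigD1 i)//= eqxx scale1r big1 ?addr0// => j /negbTE ->;
    rewrite scale0r.
Qed.

(** The hull is the image of the standard simplex under [c *m A]; the simplex is bounded because its
    weights satisfy [c i ^+ 2 <= c i]. *)
Lemma conv_hull_compact n (a : 'I_n -> E) : compact (conv_hull a).
Proof.
pose S := [set c : 'rV[R]_n | (forall i, 0 <= c 0 i) /\ \sum_i c 0 i = 1].
pose A : 'M[R]_(n, d) := \matrix_i a i.
have -> : conv_hull a = (fun c : 'rV[R]_n => c *m A) @` S.
  have AE (c : 'rV[R]_n) : c *m A = \sum_i c 0 i *: a i.
    by rewrite mulmx_sum_row; apply: eq_bigr => i _; rewrite rowK.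
  apply/seteqP; split => x.
    move=> [c [c0 c1 ->]]; exists (\row_i c i).
      by split => [i|]; [rewrite mxE|rewrite -c1; apply: eq_bigr => i _;
        rewrite mxE].
    by rewrite AE; apply: eq_bigr => i _; rewrite mxE.
  by move=> [c [c0 c1] <-]; exists (c 0); split.
apply: continuous_compact.
  apply: continuous_subspaceT; apply: continuous_mx => i j.
  rewrite (ord1 i).
  have -> : (fun c : 'rV[R]_n => (c *m A) 0 j) = (fun c => ((c - 0) *m A) 0 j).
    by apply/funext => c; rewrite subr0.
  exact: continuous_affine.
apply: bounded_closed_compact.
  exists 2; split => //= M M2 c [c0 c1]; apply: ltW.
  apply: lt_trans M2; apply: norm_le_dotp => //.
  apply: (@le_lt_trans _ _ (\sum_i c 0 i)); last by rewrite c1; lra.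
  rewrite dotpE; apply: ler_sum => i _; rewrite ler_piMl//.
  by rewrite -c1 (bigD1 i)//= lerDl sumr_ge0.
have -> : S = (\bigcap_(i in [set: 'I_n]) [set c : 'rV[R]_n | 0 <= c 0 i]) `&`
    [set c : 'rV[R]_n | \sum_i c 0 i = 1].
  by apply/seteqP; split => c /= [h1 h2]; split => // i; [move=> _;
    exact: h1|exact: (h1 i I)].
apply: closedI.
  apply: closed_bigI => i _.
  apply: (@closed_comp _ _ (fun c : 'rV[R]_n => c 0 i) [set r | 0 <= r]);
    last exact: closed_ge.
  by move=> c _; exact: coord_continuous.
apply: (@closed_comp _ _ (fun c : 'rV[R]_n => \sum_i c 0 i) [set 1]);
  last exact: closed_eq.
by move=> c _; apply: continuous_sumr => i; exact: coord_continuous.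
Qed.

Lemma compact_lattice_finite Q : compact Q -> finite_set (Q `&` lattice).
Proof.
move=> /compact_bounded[M [Mr MQ]].
pose N := (Num.truncn (Num.max 0 M + 1)).+1.
have MN : Num.max 0 M + 1 < N%:R by apply: real_truncnS_gt; exact: num_real.
have QN x : Q x -> forall j, `|x 0 j| < N%:R.
  move=> Qx j; apply: le_lt_trans MN.
  have := MQ (Num.max 0 M + 1) _ x Qx; rewrite /= => h.
  have xM : `|x| <= Num.max 0 M + 1.
    by apply: h; rewrite (@le_lt_trans _ _ (Num.max 0 M))// ?le_max ?lexx
      ?orbT// ltrDl.
  apply: contraTT xM; rewrite -!ltNge => xj.
  have : ~ ball (0 : E) `|x 0 j| x.
    move=> /mx_ballP[_ /(_ 0 j)]; rewrite mxE sub0r normrN ltxx.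
    by [].
  by rewrite -ball_normE /= sub0r normrN => /negP; rewrite -leNgt;
    exact: lt_le_trans.
(* The coordinates of a lattice point of [Q] lie strictly between [- N] and [N]; shifted by [N],
   they are indices of a finite box. *)
pose f (r : 'rV['I_(N + N).+1]_d) : E := \row_j ((r 0 j)%:R - N%:R).
apply: (@sub_finite_set _ _ (f @` setT)); last first.
  by apply: finite_image; exact: finite_finset.
move=> x [Qx [z _ zx]]; exists (\row_j inord (absz (z 0%R j + N%:Z)%R)) => //.
apply/rowP => j; rewrite !mxE.
have := QN x Qx j; rewrite -zx mxE => zN.
have /andP[z1 z2] : (- N%:Z < z 0 j) && (z 0 j < N%:Z).
  by move: zN; rewrite -ltr_norml -(ltr_int R) intr_norm.
have -> : nat_of_ord (inord (absz (z 0%R j + N%:Z)%R) : 'I_(N + N).+1) =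
  absz (z 0 j + N%:Z).
  by rewrite inordK//; lia.
have -> : (absz (z 0 j + N%:Z))%:R = (z 0 j + N%:Z)%:~R :> R.
  by rewrite -[in RHS](gez0_abs (_ : 0 <= z 0 j + N%:Z)) //; lia.
by rewrite rmorphD/= addrK.
Qed.

(** Without a crossing, the parameters whose points lie in [Q1] would form a nonempty part of
    [[0, 1]], closed because [Q1] is and open as the trace of the complement of [Q2]. By
    connectedness it would contain the parameter [1] of [y]. *)
Lemma segment_crossing Q1 Q2 x y : closed Q1 -> closed Q2 -> Q1 x -> Q2 y ->
  (forall t : R, 0 <= t <= 1 -> (Q1 `|` Q2) ((1 - t) *: x + t *: y)) ->
  exists2 t : R, 0 <= t <= 1 & (Q1 `&` Q2) ((1 - t) *: x + t *: y).
Proof.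
move=> c1 c2 Qx Qy Qz; pose z (t : R) := (1 - t) *: x + t *: y.
have cz : continuous z.
  apply: continuous_mx => i j.
  have -> : (fun t : R => z t i j) = (fun t : R => (1 - t) * x i j + t * y i j).
    by apply/funext => t; rewrite /z !mxE.
  move=> t; apply: cvgD; apply: cvgM; try exact: cvg_cst; last exact: cvg_id.
  by apply: cvgB; [exact: cvg_cst|exact: cvg_id].
apply: contrapT => no.
have h : [set t | 0 <= t <= 1 /\ Q1 (z t)] = `[0, 1]%classic.
  apply: (@segment_connected R 0 1).
  - by exists 0; rewrite /= /z subr0 scale1r scale0r addr0 lexx ler01.
  - exists (z @^-1` (~` Q2)).
      by apply: open_comp; [move=> t _; exact: cz|exact: closed_openC].
    apply/seteqP; split => t /=; rewrite in_itv/=.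
      by move=> [t01 zt]; split => // zt2; apply: no; exists t.
    by move=> [t01 zt]; split => //; have [] := Qz t t01.
  - exists (z @^-1` Q1); first by apply: closed_comp => // t _; exact: cz.
    by apply/seteqP; split => t /=; rewrite in_itv/=.
have : `[0, 1]%classic (1 : R) by rewrite /= in_itv/= ler01 lexx.
rewrite -h /= => -[_ zt]; apply: no; exists 1; first by rewrite ler01 lexx.
by split => //; rewrite subrr scale0r add0r scale1r.
Qed.

Lemma tangent_cone_meets Q v V u : Q v ->
  (tangent_cone Q v `&` half_subspace V u <> [set 0]) <-> cone_meets Q v
    (orth_proj V) u.
Proof.
move=> Qv; split => [ne|[x Qx [xv /eqP xV xu]] e]; last first.
  have : [set (0 : E)] (x - v).
    rewrite -e; split; first by exists x, 1; rewrite scale1r.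
    by split => //; rewrite orth_projP.
  by move=> /eqP; rewrite subr_eq0 (negbTE xv).
apply: contrapT => nm; apply: ne; apply/seteqP; split => y /=; last first.
  move=> ->; split; first by exists v, 0; rewrite scale0r.
  by rewrite /half_subspace /= mem0v dot0p.
move=> [[x [lam [Qx lam0 ->]]] [yV yu]].
have [->|l0] := eqVneq lam 0; first by rewrite scale0r.
have [->|xv] := eqVneq x v; first by rewrite subrr scaler0.
exfalso; apply: nm; exists x => //; split => //.
  by apply/eqP; rewrite -orth_projP; move: yV; rewrite rpredZeq (negbTE l0).
by move: yu; rewrite dotpZl pmulr_rge0// lt_def l0.
Qed.

Lemma cone_meets_setI Q1 Q2 v V u : closed Q1 -> closed Q2 ->
  is_convex (Q1 `|` Q2) ->
  Q1 v -> Q2 v ->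
  (forall x, (Q1 `|` Q2) (v + x) -> (Q1 `|` Q2) (v - x) -> x != 0 -> x \in V ->
    exists y, [/\ (Q1 `|` Q2) (v + y), y \in V & 0 < dotp y u]) ->
  cone_meets Q1 v (orth_proj V) u -> cone_meets Q2 v (orth_proj V) u ->
  cone_meets (Q1 `&` Q2) v (orth_proj V) u.
Proof.
move=> c1 c2 cv Q1v Q2v H [z1 Qz1 [z1v z1V z1u]] [z2 Qz2 [z2v z2V z2u]].
have zB (x y : E) (t : R) : (1 - t) *: x + t *: y - v =
  (1 - t) *: (x - v) + t *: (y - v).
  rewrite !scalerBr addrACA -opprD -scalerDl subrK scale1r //.
have seg x y : Q1 x -> Q2 y -> x - v \in V -> y - v \in V ->
    0 <= dotp (x - v) u -> 0 <= dotp (y - v) u ->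
    (forall t : R, 0 <= t <= 1 -> (1 - t) *: (x - v) + t *: (y - v) != 0) ->
    cone_meets (Q1 `&` Q2) v (orth_proj V) u.
  move=> Qx Qy xV yV xu yu nv.
  have [t t01|t t01 Qt] := segment_crossing c1 c2 Qx Qy.
    by apply: cv => //; [left|right].
  exists ((1 - t) *: x + t *: y) => //; have /andP[t0 t1] := t01; split.
  - by rewrite -subr_eq0 zB nv.
  - by apply/eqP; rewrite -orth_projP zB rpredD// memvZ.
  - by rewrite zB dotpDl !dotpZl addr_ge0// mulr_ge0// subr_ge0.
move/eqP: z1V; move/eqP: z2V; rewrite -!orth_projP => z2V z1V.
have [[t [t01 tv]]|nt] := pselect (exists t : R,
  0 <= t <= 1 /\ (1 - t) *: (z1 - v) + t *: (z2 - v) = 0); last first.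
  by apply: (seg z1 z2) => // t t01; apply/eqP => e; apply: nt; exists t.
have /andP[t0 t1] := t01.
have t1' : t != 1.
  apply/eqP => e; move: tv; rewrite e subrr scale0r add0r scale1r => /eqP.
  by rewrite subr_eq0 (negbTE z2v).
pose x := (1 - t) *: (z1 - v).
have xE : x = - (t *: (z2 - v)) by apply/eqP; rewrite -addr_eq0 tv.
have [||||y [Qy yV yu]] := H x.
- rewrite (_ : v + x = (1 - (1 - t)) *: v + (1 - t) *: z1).
    by apply: cv; [left|left|rewrite subr_ge0 t1 lerBlDr lerDl].
  by rewrite /x; apply/rowP => i; rewrite !mxE; ring.
- rewrite xE opprK (_ : v + _ = (1 - t) *: v + t *: z2).
    by apply: cv => //; right.
  by apply/rowP => i; rewrite !mxE; ring.
- by rewrite /x scaler_eq0 subr_eq0 eq_sym (negbTE t1') subr_eq0.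
- by rewrite memvZ.
have yE : v + y - v = y by rewrite addrC addKr.
(* Away from the endpoint [z], the combination has positive product with [u], and [z] itself is
   nonzero; hence a segment issued from [v + y] avoids [v]. *)
have pos (s : R) (z : E) : 0 <= s <= 1 -> z != 0 -> 0 <= dotp z u ->
  (1 - s) *: y + s *: z != 0.
  move=> /andP[s0 s1] z0 zu; apply/eqP => e.
  have [s1'|s1'] := eqVneq s 1.
    by move: e; rewrite s1' subrr scale0r add0r scale1r => /eqP;
      rewrite (negbTE z0).
  have := congr1 (fun r => dotp r u) e; rewrite dotpDl !dotpZl dot0p => /eqP.
  rewrite gt_eqF// ltr_pwDl ?mulr_gt0 ?mulr_ge0// subr_gt0.
  by rewrite lt_neqAle s1'.
(* [v + y] replaces whichever of [z1] and [z2] belongs to the same polytope. *)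
case: Qy => Qy.
  apply: (seg (v + y) z2) => //; rewrite yE ?(ltW yu)// => s s01.
  by apply: pos => //; rewrite subr_eq0.
apply: (seg z1 (v + y)) => //; rewrite yE ?(ltW yu)// => s /andP[s0 s1].
rewrite addrC -{1}(subKr 1 s); apply: pos => //; last by rewrite subr_eq0.
by rewrite subr_ge0 s1 lerBlDr lerDl.
Qed.

End Polytopes.

(** * Grassmann angle valuations *)

Section GrassmannAngles.
Context {R : realType} {d : nat}.
Local Notation E := 'rV[R]_d.
Local Notation MM := 'M[R]_d.
Context {disp : measure_display} {Omega : measurableType disp}.
Context (P : probability Omega R).
Context (W : nat -> Omega -> {vspace E}) (U : Omega -> E).
Hypothesis unifW : forall m, (m <= d)%N -> uniform_subspace P m (W m).
Hypothesis unifU : uniform_on_sphere P fullv U.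
Hypothesis indepWU : forall m, (m <= d)%N -> independent P (W m) U.
Hypothesis d_gt0 : (0 < d)%N.

Local Notation pW := (pW W).
Let mU : measurable_fun setT (U : Omega -> borel E) := measurable_U unifU.
Let mW m (md : (m <= d)%N) : measurable_fun setT (pW m) := measurable_pW unifW
  md.

Definition angle k (Q : set E) (v : E) : R :=
  fine (P [set w | cone_meets Q v (pW (d - k) w) (U w)]).

Lemma grassmann_valE k Q :
  grassmann_val P W U k Q = \sum_(v \in Q `&` lattice) angle k Q v.
Proof.
apply: eq_fsbigr => v; rewrite inE => -[Qv _].
congr (fine (P _)); apply/funext => w; apply/propext.
exact: (tangent_cone_meets (W (d - k) w) (U w) Qv).
Qed.

Lemma grassmann_val_translation k :
  translation_invariant (grassmann_val P W U k).
Proof.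
move=> Q t _ [z _ zt].
rewrite /grassmann_val (@reindex_fsbig _ _ _ _ _ (fun v =>
  t + v) (Q `&` lattice)).
  apply: eq_fsbigr => v _; congr (fine (P _)); apply/funext => w.
  congr (_ `&` _ <> _); apply/seteqP; split => y /=.
    move=> [_ [lam [[x Qx <-] l0 ->]]]; exists x, lam; split => //.
    by rewrite /= opprD addrACA subrr add0r.
  move=> [x [lam [Qx l0 ->]]]; exists (t + x), lam; split => //;
    first by exists x.
  by rewrite /= opprD addrACA subrr add0r.
split.
- move=> v /= [Qv [s _ sv]]; split; first by exists v.
  by exists (z + s) => //; rewrite map_mxD zt sv.
- by move=> x y _ _; exact: addrI.
- move=> _ [[x Qx <-] [s _ sx]]; exists x => //; split => //.
  by exists (s - z) => //; rewrite map_mxB zt sx addrC addKr.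
Qed.

Lemma measurable_cone_meets k (Q : set E) v : compact Q ->
  measurable [set w | cone_meets Q v (pW (d - k) w) (U w)].
Proof. move=> cQ; exact: (measurable_meets_W unifW unifU v (leq_subr k d) cQ).
  Qed.

Lemma compact_closed_rV (Q : set E) : compact Q -> closed Q.
Proof. by move=> cQ; apply: compact_closed => //; exact: norm_hausdorff. Qed.

Lemma fine_measureU (A B : set Omega) : measurable A -> measurable B ->
  fine (P (A `|` B)) = fine (P A) + fine (P B) - fine (P (A `&` B)).
Proof.
move=> mA mB; rewrite measureUfinr// ?(le_lt_trans (probability_le1 _ _))
  ?ltry//.
have mI := measurableI _ _ mA mB.
by rewrite fineB ?fineD// ?fin_numD ?fin_num_measure.
Qed.

(** The compact symmetric set to which [symmetric_null] is applied: its nonzero elements are the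
    half-lengths of segments with ends in [Q] and midpoint [v]. *)
Lemma compact_symmetrize (Q : set E) v : compact Q ->
  compact [set x | Q (v + x) /\ Q (v - x)].
Proof.
move=> cQ.
have tr (f : E -> E) : continuous f -> compact (f @` Q).
  by move=> cf; apply: continuous_compact => //; exact: continuous_subspaceT.
have h1 : compact ((fun x => x - v) @` Q).
  by apply: tr => x; apply: (@continuousB _ E);
    [exact: cvg_id|exact: cst_continuous].
have h2 : compact ((fun x => v - x) @` Q).
  by apply: tr => x; apply: (@continuousB _ E);
    [exact: cst_continuous|exact: cvg_id].
rewrite (_ : mkset _ = ((fun x => x - v) @` Q) `&` ((fun x => v - x) @` Q)).
  by apply: compact_closedI => //; exact: compact_closed_rV.
apply/seteqP; split => x /= [].
  move=> q1 q2; split; first by exists (v + x) => //; apply/rowP => i;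
    rewrite !mxE; ring.
  by exists (v - x) => //; apply/rowP => i; rewrite !mxE; ring.
move=> [y Qy <-] [z Qz zE]; rewrite subrKC; split => //.
by rewrite -zE subKr.
Qed.

(** Inclusion-exclusion for two events: the union of the events is exactly the event of the union,
    while their intersection agrees with the event of the intersection only outside a null set. *)
Lemma angle_setU k (Q1 Q2 : set E) v : (k <= d)%N ->
  compact Q1 -> compact Q2 -> is_convex (Q1 `|` Q2) -> Q1 v -> Q2 v ->
  angle k (Q1 `|` Q2) v = angle k Q1 v + angle k Q2 v - angle k (Q1 `&` Q2) v.
Proof.
move=> kd c1 c2 cv Q1v Q2v.
have cl1 := compact_closed_rV c1; have cl2 := compact_closed_rV c2.
have cU : compact (Q1 `|` Q2) by exact: compactU.
have cI : compact (Q1 `&` Q2) by exact: compact_closedI.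
have m1 := measurable_cone_meets k v c1;
  have m2 := measurable_cone_meets k v c2.
rewrite /angle.
rewrite (_ : [set w | cone_meets (Q1 `|` Q2) v (pW (d - k) w) (U w)] =
  [set w | cone_meets Q1 v (pW (d - k) w) (U w)] `|`
  [set w | cone_meets Q2 v (pW (d - k) w) (U w)]); last first.
  apply/seteqP; split => w /=.
    by move=> [x [Qx|Qx] h]; [left|right]; exists x.
  by move=> [[x Qx h]|[x Qx h]]; exists x => //; [left|right].
rewrite fine_measureU//; congr (_ - fine _).
have [|N [mN N0 NP]] := symmetric_null unifW unifU indepWU d_gt0 (leq_subr k d)
  (compact_symmetrize (v := v) cU).
  by move=> x /= [? ?]; rewrite opprK.
apply: (null_eq _ _ mN N0).
- exact: measurableI.
- exact: measurable_cone_meets.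
move=> w Nw /=; split; last by move=> [x [Q1x Q2x] h]; split; exists x.
move=> [h1 h2]; apply: cone_meets_setI => // x q1 q2 x0 xW.
by have [y [[Qy _] yW yu]] := NP w Nw x (conj q1 q2) x0 xW; exists y.
Qed.

(** Moving [x] towards [v] keeps the direction of [x - v], and near [v] the union coincides with
    [Q1] since [Q2] is closed. *)
Lemma angle_local k (Q1 Q2 : set E) v : is_convex (Q1 `|` Q2) -> closed Q2 ->
  Q1 v -> ~ Q2 v -> angle k (Q1 `|` Q2) v = angle k Q1 v.
Proof.
move=> cv c2 Q1v nQ2v; congr (fine (P _)); apply/seteqP; split => w /=;
  last first.
  by move=> [x Qx h]; exists x => //; left.
move=> [x Qx [xv xW xu]].
have /nbhs_ballP[e /= e0 eQ] : nbhs v (~` Q2).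
  by apply: open_nbhs_nbhs; split => //; exact: closed_openC.
pose s := Num.min 1 (e / (`|x - v| + 1)).
have n0 : 0 < `|x - v| + 1 by rewrite ltr_wpDl.
have s0 : 0 < s by rewrite lt_min ltr01 divr_gt0.
have s1 : s <= 1 by rewrite ge_min lexx.
have zE : (1 - s) *: v + s *: x - v = s *: (x - v).
  by apply/rowP => i; rewrite !mxE; ring.
exists ((1 - s) *: v + s *: x).
  have [//|Q2z] := cv v x s (or_introl Q1v) Qx (introT andP (conj (ltW s0) s1)).
  exfalso; apply: (eQ _ _ Q2z).
  rewrite -ball_normE /= -normrN opprB zE normrZ gtr0_norm//.
  have se : s <= e / (`|x - v| + 1) by rewrite ge_min lexx orbT.
  rewrite -(@ltr_pM2r _ (`|x - v| + 1)^-1) ?invr_gt0//.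
  apply: lt_le_trans se; rewrite -mulrA gtr_pMr// ltr_pdivrMr// mul1r ltrDl//.
split; rewrite ?zE.
- by rewrite -subr_eq0 zE scaler_eq0 gt_eqF// subr_eq0.
- by rewrite -scalemxAl xW.
- by rewrite dotpZl mulr_ge0// ltW.
Qed.

Lemma grassmann_val_valuation k : (k <= d)%N ->
  is_valuation (grassmann_val P W U k).
Proof.
move=> kd; split; first by rewrite grassmann_valE fsbig1// => v [].
move=> Q1 Q2 [n1 [a1 [l1 Q1E]]] [n2 [a2 [l2 Q2E]]] [n [a [l QE]]].
have c1 : compact Q1 by rewrite Q1E; exact: conv_hull_compact.
have c2 : compact Q2 by rewrite Q2E; exact: conv_hull_compact.
have cU : compact (Q1 `|` Q2) by exact: compactU.
have cv : is_convex (Q1 `|` Q2) by rewrite QE; exact: conv_hull_convex.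
have finU := compact_lattice_finite cU.
rewrite !grassmann_valE.
(* The four sums range over different lattice sets; extending the angle by zero outside the polytope
   allows a pointwise comparison over the union. *)
pose f Q' v := if `[<Q' v>] then angle k Q' v else 0.
have fT Q' v : Q' v -> f Q' v = angle k Q' v by move=> h; rewrite /f asboolT.
have fF Q' v : ~ Q' v -> f Q' v = 0 by move=> h; rewrite /f asboolF.
have extend Q' : Q' `<=` Q1 `|` Q2 ->
    \sum_(v \in Q' `&` lattice) angle k Q' v =
      \sum_(v \in (Q1 `|` Q2) `&` lattice) f Q' v.
  move=> Q'Q; rewrite (eq_fsbigr (f Q')).
    apply: fsbig_widen; first by move=> v [/Q'Q Qv Lv].
    by move=> v /= [[Qv Lv] nQ']; apply: fF => Q'v; apply: nQ'.
  by move=> v; rewrite inE => -[Q'v _]; rewrite fT.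
rewrite (extend (Q1 `|` Q2))// (extend Q1); last by move=> v; left.
rewrite (extend Q2); last by move=> v; right.
rewrite (extend (Q1 `&` Q2)); last by move=> v [? _]; left.
apply/eqP; rewrite eq_sym subr_eq eq_sym -!fsbig_split//=; apply/eqP.
apply: eq_fsbigr => v; rewrite inE => -[Qv _].
rewrite (fT _ _ Qv).
have [Q1v|Q1v] := pselect (Q1 v); have [Q2v|Q2v] := pselect (Q2 v).
- by rewrite !fT// angle_setU// subrK.
- rewrite (fT Q1)// !(fF Q2, fF (Q1 `&` Q2))// ?addr0; last by case.
  by rewrite (angle_local k cv (compact_closed_rV c2)).
- rewrite (fT Q2)// !(fF Q1, fF (Q1 `&` Q2))// ?addr0 ?add0r; last by case.
  by move: cv; rewrite setUC => cv;
    rewrite (angle_local k cv (compact_closed_rV c1)).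
- by case: Qv.
Qed.

Lemma grassmann_val_top Q : grassmann_val P W U d Q = 0.
Proof.
rewrite grassmann_valE fsbig1// => v _; rewrite /angle subnn.
rewrite (_ : mkset _ = set0) ?measure0//; apply/seteqP;
  split => w // [x _ [xv]].
have W0 : W 0 w = 0%VS by apply/eqP; rewrite -dimv_eq0 (dim_W unifW).
by move=> /mul_pW; rewrite W0 memv0 subr_eq0 (negbTE xv).
Qed.

Lemma aff_hull_sub (Q : set E) x : Q x -> aff_hull Q x.
Proof.
move=> Qx; exists 1%N, (fun=> x), (fun=> 1); split => //.
  by rewrite big_ord1.
by rewrite big_ord1 scale1r.
Qed.

(** All differences [x - v] lie in the direction space of the affine hull, whose dimension is at
    most [k], and [W (d - k)] almost surely meets that space only at the origin. *)
Lemma angle_eq0 k (Q : set E) v : compact Q -> Q v ->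
  (poly_dim Q <= k <= d)%N ->
  angle k Q v = 0.
Proof.
move=> cQ Qv /andP[Qk kd].
pose L := lin_hull [set x - y | x in aff_hull Q & y in aff_hull Q].
have QL x : Q x -> x - v \in L.
  move=> Qx; apply: (lin_hullP _).1; exists x; first exact: aff_hull_sub.
  by exists v => //; exact: aff_hull_sub.
have [|mN N0] := generic_disjoint unifW unifU d_gt0 (L := L) (leq_subr k d).
  by apply: leq_trans (leq_add (leqnn (d - k)) Qk) _; rewrite subnK.
rewrite /angle (null_sub (measurable_cone_meets k v cQ) mN N0)// =>
  w [x Qx [xv xW _]].
have x0 : 0 < dotp (x - v) (x - v) by rewrite dotpp_gt0 subr_eq0.
exists ((Num.sqrt (dotp (x - v) (x - v)))^-1 *: (x - v));
  last by rewrite -scalemxAl xW.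
split; first by rewrite memvZ// QL.
by rewrite dotpZl dotpZr mulrA -invfM -expr2 sqr_sqrtr ?(ltW x0)// mulVf//
  gt_eqF.
Qed.

Lemma grassmann_val_eq0 k (Q : set E) : compact Q -> (poly_dim Q <= k <= d)%N ->
  grassmann_val P W U k Q = 0.
Proof.
by move=> cQ Qk; rewrite grassmann_valE fsbig1// => v [Qv _]; exact: angle_eq0.
Qed.

Lemma grassmann_val_le k (Q : set E) : compact Q -> (k < d)%N ->
  grassmann_val P W U k.+1 Q <= grassmann_val P W U k Q.
Proof.
move=> cQ kd; rewrite !grassmann_valE -lee_fin -!fsumEFin;
  try exact: compact_lattice_finite.
apply: lee_fsum; first exact: compact_lattice_finite.
move=> v _; rewrite /angle !fineK ?fin_num_measure//;
  try exact: measurable_cone_meets.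
have -> : (d - k = (d - k.+1).+1)%N by rewrite subnSK.
apply: (meets_succ_le unifW unifU indepWU d_gt0) => //.
by rewrite ltn_subrL.
Qed.

End GrassmannAngles.

(** * The indices 0 and d - 1: lattice points and solid angles *)

Section SolidAngles.
Context {R : realType} {d : nat}.
Local Notation E := 'rV[R]_d.
Local Notation MM := 'M[R]_d.
Context {disp : measure_display} {Omega : measurableType disp}.
Context (P : probability Omega R).
Context (W : nat -> Omega -> {vspace E}) (U : Omega -> E).
Hypothesis unifW : forall m, (m <= d)%N -> uniform_subspace P m (W m).
Hypothesis unifU : uniform_on_sphere P fullv U.
Hypothesis indepWU : forall m, (m <= d)%N -> independent P (W m) U.
Hypothesis d_gt0 : (0 < d)%N.

Local Notation pW := (pW W).
Let mU : measurable_fun setT (U : Omega -> borel E) := measurable_U unifU.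
Let mW m (md : (m <= d)%N) : measurable_fun setT (pW m) := measurable_pW unifW
  md.

Lemma cone_meets_full (Q : set E) v w :
  cone_meets Q v (pW (d - 0) w) (U w) <->
  exists2 x, Q x & x != v /\ 0 <= dotp (x - v) (U w).
Proof.
have Wd : W (d - 0) w = fullv.
  by apply/eqP; rewrite eqEdim subvf/= dim_rV subn0 (dim_W unifW).
split => [[x Qx [xv _ xu]]|[x Qx [xv xu]]]; exists x => //.
by split => //; apply/mul_pW; rewrite Wd memvf.
Qed.

(** A linear functional attains its maximum over the hull at a generator, so uniqueness of the
    maximiser only requires excluding ties between finitely many points. Generators may be repeated,
    whence the conclusion [a i = a j]. *)
Lemma direction_tie_null n (a : 'I_n -> E) :
  exists N, [/\ measurable N, P N = 0%E &
    forall w, ~ N w -> forall i j, dotp (a i - a j) (U w) = 0 -> a i = a j].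
Proof.
pose F (m : nat) : set Omega := if unpickle m is Some (i, j)
  then (if a i == a j then set0 else [set w | dotp (U w) (a i - a j) =
    0]) else set0.
have mF m : measurable (F m).
  rewrite /F; case: unpickle => [[i j]|]//; case: eqP => // _.
  by apply: measurable_set_eq; exact: measurable_cst_dotp.
exists (\bigcup_m F m); split; first exact: bigcupT_measurable.
  apply: measure_negligible; first exact: bigcupT_measurable.
  apply: negligible_bigcup => m; apply/negligibleP; first exact: mF.
  rewrite /F; case: unpickle => [[i j]|]//; case: eqP => // ij.
  by apply: (hyperplane_null unifU d_gt0); rewrite subr_eq0; apply/eqP.
move=> w nN i j; rewrite dotpC => aij; apply: contrapT => ij; apply: nN.
exists (pickle (i, j)) => //; rewrite /F pickleK /=.
by move/eqP/negbTE: ij => ->.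
Qed.

Lemma grassmann_val0 n (a : 'I_n -> E) : (forall i, lattice (a i)) ->
  conv_hull a !=set0 ->
  grassmann_val P W U 0 (conv_hull a) = num_points (conv_hull a) - 1.
Proof.
move=> la [q Qq]; set Q := conv_hull a in Qq *.
have cQ : compact Q by exact: conv_hull_compact.
have finQ := compact_lattice_finite cQ.
(* [B v] is the event that [v] is the strict maximiser of the product with [U] over [Q]. These
   events are disjoint and almost surely one of them occurs, so their probabilities add up to the
   [1] that is subtracted. *)
pose B v := ~` [set w | cone_meets Q v (pW (d - 0) w) (U w)].
have mB v : measurable (B v).
  by apply: measurableC; exact: (measurable_cone_meets unifW unifU).
have BP v w : B v w <-> forall x, Q x -> x != v -> dotp (x - v) (U w) < 0.
  split=> [nm x Qx xv|h]; first rewrite ltNge.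
    by apply/negP => xu; apply: nm; apply/cone_meets_full; exists x.
  by move=> /cone_meets_full[x Qx [xv]]; rewrite leNgt h.
have [N [mN N0 NP]] := direction_tie_null a.
have unionB : P (\bigcup_(v in Q `&` lattice) B v) = 1%E.
  rewrite -(probability_setT P); apply: (null_eq _ _ mN N0) => //.
    by apply: fin_bigcup_measurable.
  move=> w /NP ntie; split => // _.
  have [i0 _] : exists i0 : 'I_n, True.
    have [c [_ c1 _]] := Qq; apply: contrapT => noI.
    move/eqP: c1; rewrite big1 ?(eq_sym 0) ?oner_eq0// => i _.
    by exfalso; apply: noI; exists i.
  have [i _ imax] := @arg_maxP _ _ _ i0 predT (fun i => dotp (a i) (U w)) isT.
  exists (a i); first by split; [exact: conv_hull_vertex|exact: la].
  apply/BP => x [c [c0 c1 xE]] xv; rewrite lt_def.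
  have aj j : dotp (a j - a i) (U w) <= 0.
    by rewrite dotpBl subr_le0; exact: imax.
  have xaE : x - a i = \sum_j c j *: (a j - a i).
    under eq_bigr do rewrite scalerBr.
    by rewrite sumrB -scaler_suml c1 scale1r -xE.
  have term j : c j * dotp (a j - a i) (U w) <= 0 by rewrite mulr_ge0_le0.
  have sE : dotp (x - a i) (U w) = \sum_j c j * dotp (a j - a i) (U w).
    by rewrite xaE dotp_suml; apply: eq_bigr => j _; rewrite dotpZl.
  (* All terms are nonpositive. If their sum vanishes, every [j] has [c j = 0] or ties with [i], so
     that [a j = a i]; then [x] equals [a i]. *)
  rewrite sE sumr_le0 ?andbT//; apply: contra xv => /eqP/esym s0.
  have : \sum_j - (c j * dotp (a j - a i) (U w)) = 0 by rewrite sumrN s0 oppr0.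
  move=> /eqP; rewrite psumr_eq0 => [/allP all0|j _]; last by rewrite oppr_ge0.
  rewrite -subr_eq0 xaE big1// => j _; have := all0 j (mem_index_enum j).
  rewrite /= oppr_eq0 mulf_eq0 => /orP[/eqP ->|/eqP /ntie ->].
    by rewrite scale0r.
  by rewrite subrr scaler0.
have trivB : trivIset (Q `&` lattice) B.
  move=> v v' [Qv _] [Qv' _] [w [/BP Bv /BP Bv']].
  apply/eqP; apply: contraT => vv'.
  have := Bv' v Qv vv'; have := Bv v' Qv'; rewrite eq_sym => /(_ vv').
  by rewrite !dotpBl; lra.
have sumB : \sum_(v \in Q `&` lattice) fine (P (B v)) = 1.
  apply: (@EFin_inj R); rewrite -fsumEFin// -unionB measure_fin_bigcup//.
  by apply: eq_fsbigr => v _; rewrite fineK// fin_num_measure.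
rewrite grassmann_valE -[X in _ - X]sumB.
apply/eqP; rewrite -(can2_eq (addrK _) (subrK _)) -fsbig_split//=; apply/eqP.
apply: eq_fsbigr => v _; rewrite /B probability_setC;
  last exact: (measurable_cone_meets unifW unifU).
rewrite fineB// ?fin_num_measure//;
  last exact: (measurable_cone_meets unifW unifU).
by rewrite /angle addrC subrK.
Qed.

(** By convexity, a multiple [lam *: (x - v)] with [lam < n.+1%:R] is also [n.+1%:R *: (x' - v)] for
    a point [x'] of [Q] between [v] and [x]. The cone is thus a countable union of compact
    dilates. *)
Lemma borel_tangent_cone (Q : set E) v : compact Q -> is_convex Q -> Q v ->
  measurable (tangent_cone Q v : set (borel E)).
Proof.
move=> cQ cv Qv.
rewrite (_ : tangent_cone Q v = \bigcup_n ((fun x => n.+1%:R *: (x - v)) @` Q)).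
  apply: bigcupT_measurable => n; apply: closed_borel; apply: compact_closed_rV.
  apply: continuous_compact => //; apply: continuous_subspaceT.
  apply: continuous_mx => i j; rewrite (ord1 i).
  have -> : (fun x : E => (n.+1%:R *: (x - v)) 0 j) = (fun x : E =>
    ((x - v) *m (n.+1%:R%:M)) 0 j).
    by apply/funext => x; rewrite mul_mx_scalar.
  exact: continuous_affine.
apply/seteqP; split => y.
  move=> [x [lam [Qx l0 ->]]].
  pose n := Num.truncn lam.
  have ln : lam < n.+1%:R by apply: real_truncnS_gt; exact: num_real.
  have n0 : 0 < n.+1%:R :> R by [].
  pose t := lam / n.+1%:R.
  exists n => //; exists ((1 - t) *: v + t *: x).
    apply: cv => //; rewrite divr_ge0 ?(ltW n0)//=.
    by rewrite ler_pdivrMr// mul1r ltW.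
  rewrite (_ : _ - v = t *: (x - v)); last by apply/rowP => i; rewrite !mxE;
    ring.
  by rewrite scalerA /t mulrCA divff ?mulr1// gt_eqF.
by move=> [n _ [x Qx <-]]; exists x, n.+1%:R.
Qed.

(** The normalised projection of [u]. The default value [u] at a vanishing projection keeps the
    function commuting with rotations and, for a unit vector [u], of unit length everywhere. *)
Definition line_dir (p : MM) (u : E) : E := if u *m p == 0 then u
  else (Num.sqrt (dotp (u *m p) (u *m p)))^-1 *: (u *m p).

Lemma measurable_line_dir d' (T : measurableType d') (f : T ->
  borel MM) (u : T -> borel E) :
  measurable_fun setT f -> measurable_fun setT u ->
  measurable_fun setT (fun t => line_dir (f t) (u t) : borel E).
Proof.
move=> mf mu.
have mp : measurable_fun setT (fun t => (u t : E) *m (f t : MM) : borel E).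
  exact: measurable_mulmx.
have md := measurable_dotp mp mp.
apply: measurable_fun_ifT => //.
  apply: (@measurable_fun_bool _ _ _ _ true); rewrite setTI.
  rewrite (_ : _ @^-1` _ = [set t | dotp ((u t : E) *m
    (f t : MM)) ((u t : E) *m (f t : MM)) = 0]).
    exact: measurable_set_eq.
  by apply/seteqP; split => t /= /eqP h; apply/eqP; move: h;
    rewrite dotpp_eq0 => /eqP -> //; rewrite eqxx.
apply: measurable_scalemx => //; apply: measurable_funV.
apply: measurableT_comp md.
by apply: continuous_measurable_fun; exact: sqrt_continuous.
Qed.

Lemma line_dir_rotate (g p : MM) u : orthogonal_mx g ->
  line_dir (g^T *m p *m g) (u *m g) = line_dir p u *m g.
Proof.
move=> og; rewrite /line_dir.
have -> : u *m g *m (g^T *m p *m g) = u *m p *m g.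
  by rewrite !mulmxA -(mulmxA u) og mulmx1.
rewrite orthogonal_dotp// -[u *m p *m
  g == 0]dotpp_eq0 orthogonal_dotp// dotpp_eq0.
by case: ifP => // _; rewrite -scalemxAl.
Qed.

Lemma line_dir_unit p w : dotp (line_dir p (U w)) (line_dir p (U w)) = 1.
Proof.
rewrite /line_dir; case: ifPn => [_|y0]; first exact: (U_unit unifU).
by rewrite dotpZl dotpZr mulrA -invfM -expr2 sqr_sqrtr ?dotpp_ge0// mulVf//
  dotpp_eq0.
Qed.

Let d1 : (1 <= d)%N := d_gt0.

Lemma line_dir_invariant (g : MM) : orthogonal_mx g ->
  forall B : set (borel E), measurable B ->
  P [set w | B (line_dir (pW 1 w) (U w) *m g)] =
    P [set w | B (line_dir (pW 1 w) (U w))].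
Proof.
move=> og B mB.
have mC : measurable [set pu : borel MM * borel E | B (line_dir pu.1 pu.2)].
  apply: (@measurable_preim _ _ _ _ (fun pu : borel MM * borel E =>
    line_dir pu.1 pu.2 : borel E)) => //.
  by apply: measurable_line_dir; [exact: measurable_fst|exact: measurable_snd].
have mC' : measurable [set pu : borel MM * borel E | B (line_dir pu.1 pu.2 *m
  g)].
  apply: (@measurable_preim _ _ _ _ (fun pu : borel MM * borel E =>
    line_dir pu.1 pu.2 *m g : borel E)) => //.
  apply: measurable_mulmx => //.
  by apply: measurable_line_dir; [exact: measurable_fst|exact: measurable_snd].
have e1 := independent_law unifW unifU indepWU d1 mC.
have e2 := independent_law unifW unifU indepWU d1 mC'.
apply: (etrans e2); apply: esym; apply: (etrans e1).
rewrite -(joint_invariant unifW unifU d1 og mC); congr ((P \x P)%E _).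
by apply/seteqP; split => w /=; rewrite line_dir_rotate.
Qed.

(** For a fixed line, the projection of [U] vanishes only if [U] is orthogonal to a nonzero vector
    of that line. *)
Lemma proj_null : exists N, [/\ measurable N, P N = 0%E &
  forall w, ~ N w -> U w *m (pW 1 w : MM) != 0].
Proof.
pose C := [set pu : borel MM * borel E | dotp (pu.2 *m (pu.1 : MM)) (pu.2 *m
  (pu.1 : MM)) = 0].
have mC : measurable C.
  have mp : measurable_fun setT (fun pu : borel MM * borel E =>
    pu.2 *m (pu.1 : MM) : borel E).
    by apply: measurable_mulmx; [exact: measurable_snd|exact: measurable_fst].
  by apply: measurable_set_eq; exact: measurable_dotp.
exists [set w | C (pW 1 w, U w)]; split.
- apply: (@measurable_preim _ _ _ _ (fun w => (pW 1 w, U w : borel E))) => //.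
  by apply: measurable_fun_pair => //; exact: mW.
- rewrite (independent_law unifW unifU indepWU d1 mC).
  have mP : measurable [set w : Omega * Omega | C (pW 1 w.1, U w.2)].
    apply: (@measurable_preim _ _ _ _ (fun w : Omega * Omega =>
      (pW 1 w.1, U w.2 : borel E))) => //.
    exact: (measurable_pWU unifW unifU d1).
  apply: (product_null (N := set0)) => // w _.
  have : W 1 w != 0%VS by rewrite -dimv_eq0 (dim_W unifW).
  rewrite -vpick0; set x := vpick _ => x0.
  have xW : x \in W 1 w by exact: memv_pick.
  apply: (null_sub (N := [set y | dotp (U y) x = 0])).
  + exact: measurable_xsection.
  + by apply: measurable_set_eq; exact: measurable_cst_dotp.
  + exact: (hyperplane_null unifU d_gt0).
  move=> y; rewrite /xsection /= inE /= => /eqP; rewrite dotpp_eq0 => /eqP y0.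
  by rewrite -(orth_proj_id xW) -orth_proj_dotp -/(pW 1 w) y0 dot0p.
- by move=> w nC; apply/eqP => e; apply: nC; rewrite /C /= e dot0p.
Qed.

Lemma ray_meets (Q : set E) v w : U w *m (pW 1 w : MM) != 0 ->
  cone_meets Q v (pW 1 w) (U w) <-> tangent_cone Q v (line_dir (pW 1 w) (U w)).
Proof.
set y := U w *m _ => y0; rewrite /line_dir -/y (negbTE y0).
set r := (Num.sqrt _)^-1.
have r0 : 0 < r by rewrite invr_gt0 sqrtr_gt0 dotpp_gt0.
have yW : y \in W 1 w by exact: orth_proj_mem.
(* Thus [dotp (a *: y) (U w)] has the sign of [a], and the half-line of [W 1] is the ray spanned by
   [y]. *)
have yU : dotp y (U w) = dotp y y.
  by rewrite -{1}(orth_proj_id yW) orth_proj_dotp.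
split.
  move=> [x Qx [xv /mul_pW xW xu]].
  have yS : (<[y]> <= W 1 w)%VS by rewrite -memvE.
  have Wy : W 1 w = <[y]>%VS.
    by apply/esym/eqP; rewrite eqEdim yS dim_vline y0 (dim_W unifW).
  move: xW; rewrite Wy => /vlineP[a xE].
  have a0 : 0 < a.
    rewrite lt_def; apply/andP; split.
      by apply: contraNneq xv => a0; rewrite -subr_eq0 xE a0 scale0r eqxx.
    by move: xu; rewrite xE dotpZl yU pmulr_lge0 ?dotpp_gt0.
  exists x, (r * a^-1); split => //; first by apply: mulr_ge0;
    [exact: ltW|rewrite invr_ge0 ltW].
  by rewrite xE scalerA mulfVK// gt_eqF.
move=> [x [lam [Qx l0 e]]].
have lam0 : 0 < lam.
  rewrite lt_def l0 andbT; apply: contraNneq y0 => lz.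
  by move/eqP: e; rewrite lz scale0r scaler_eq0 gt_eqF.
have xE : x - v = (lam^-1 * r) *: y by rewrite -scalerA e scalerA mulVf
  ?scale1r// gt_eqF.
have c0 : 0 < lam^-1 * r by rewrite mulr_gt0// invr_gt0.
exists x => //; split.
- by rewrite -subr_eq0 xE scaler_eq0 gt_eqF.
- by apply/mul_pW; rewrite xE memvZ.
- by rewrite xE dotpZl yU mulr_ge0 ?dotpp_ge0// ltW.
Qed.

Lemma lin_hull_tangent_cone (Q : set E) v : Q v -> poly_dim Q = d ->
  lin_hull (tangent_cone Q v) = fullv.
Proof.
move=> Qv Qd; apply/eqP; rewrite eqEsubv subvf /=.
pose L := lin_hull [set x - y | x in aff_hull Q & y in aff_hull Q].
have -> : fullv = L by apply/esym/eqP; rewrite eqEdim subvf/= dim_rV -{1}Qd.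
apply: (lin_hullP _).2 => _ [x ax [y ay <-]].
have aff z : aff_hull Q z -> z - v \in lin_hull (tangent_cone Q v).
  move=> [n [a [c [Qa c1 ->]]]].
  rewrite -[v in _ - v]scale1r -c1 scaler_suml -sumrB; apply: rpred_sum => i _.
  rewrite -scalerBr memvZ//; apply: (lin_hullP _).1.
  by exists (a i), 1; rewrite scale1r.
by rewrite -(subrKA v x) -[v - y]opprB rpredD ?rpredN ?aff.
Qed.

Lemma grassmann_val_solid_angle (Theta : {vspace E} -> Omega -> E) (Q : set E) :
  uniform_on_sphere P fullv (Theta fullv) -> compact Q -> is_convex Q ->
  grassmann_val P W U d.-1 Q = solid_angle_val P Theta Q.
Proof.
move=> unifT cQ cv; rewrite /solid_angle_val; case: eqP => Qd; last first.
  (* Below full dimension the solid-angle valuation is [0] by definition, and [d.-1] is at least the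
     dimension of [Q]. *)
  apply: (grassmann_val_eq0 unifW unifU d_gt0) => //; rewrite leq_pred andbT.
  rewrite -ltnS prednK// ltn_neqAle; apply/andP; split; first exact/eqP.
  by apply: leq_trans (dimvS (subvf _)) _; rewrite dim_rV.
rewrite grassmann_valE; apply: eq_fsbigr => v; rewrite inE => -[Qv _].
(* The special case of the cone [{0}] is excluded: the linear hull is the whole space, of positive
   dimension. *)
rewrite /solid_angle lin_hull_tangent_cone// asboolF; last first.
  move=> C0; have := lin_hull_tangent_cone Qv Qd;
    rewrite C0 => /(congr1 (@dimv _ _)).
  rewrite dim_rV => dE; have : (lin_hull ([set 0%R] : set E) <= 0)%VS.
    by apply: (lin_hullP _).2 => x ->; exact: mem0v.
  by rewrite subv0 -dimv_eq0 dE (gtn_eqF d_gt0).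
have -> : angle P W U d.-1 Q v =
  fine (P [set w | cone_meets Q v (pW 1 w) (U w)]).
  by rewrite /angle (_ : d - d.-1 = 1)%N//; case: (d) d_gt0 => // k _;
    rewrite subSnn.
congr fine.
have mT := borel_tangent_cone cQ cv Qv.
have mV : measurable_fun setT (fun w => line_dir (pW 1 w) (U w) : borel E).
  by apply: measurable_line_dir => //; exact: mW.
have [N [mN N0 NP]] := proj_null.
rewrite (null_eq (B := [set w | tangent_cone Q v (line_dir (pW 1 w) (U w))]) _
  _ mN N0).
- apply: (@sphere_law_unique _ _ _ _ _ _ P P (fun w =>
    line_dir (pW 1 w) (U w)) (Theta fullv)) => //.
  + exact: (measurable_U unifT).
  + by move=> w; exact: line_dir_unit.
  + by move=> w; exact: (U_unit unifT).
  + by move=> g og B mB; exact: line_dir_invariant.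
  + by move=> g og B mB; exact: (U_invariant unifT).
- exact: (measurable_meets_W unifW unifU v d1 cQ).
- exact: (measurable_preim mV mT).
- by move=> w /NP; exact: ray_meets.
Qed.

End SolidAngles.

(** For the empty polytope both [G 0] and [num_points] vanish, so the identity with
    [num_points Q - 1] is asserted for nonempty [Q]. The zero subspace contains no unit vector,
    whence the conditions [0 < d] and [L != 0]. *)
Theorem theorem1p3 (R : realType) (d : nat) (d_gt0 : (0 < d)%N)
    (disp : measure_display) (Omega : measurableType disp)
    (P : probability Omega R)
    (W : nat -> Omega -> {vspace 'rV[R]_d}) (U : Omega -> 'rV[R]_d)
    (Theta : {vspace 'rV[R]_d} -> Omega -> 'rV[R]_d)
    (unifW : forall m, (m <= d)%N -> uniform_subspace P m (W m))
    (unifU : uniform_on_sphere P fullv U)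
    (indepWU : forall m, (m <= d)%N -> independent P (W m) U)
    (unifS : forall L : {vspace 'rV[R]_d}, L != 0%VS ->
      uniform_on_sphere P L (Theta L)) :
  let G := grassmann_val P W U in
  (forall k, (k <= d)%N -> is_valuation (G k) /\ translation_invariant (G k)) /\
  (forall Q : set 'rV[R]_d, lattice_polytope Q ->
    [/\ Q !=set0 -> G 0%N Q = num_points Q - 1,
        G d.-1 Q = solid_angle_val P Theta Q,
        G d Q = 0
      & forall k : nat, poly_dim Q = k ->
        [/\ forall j, (k <= j <= d)%N -> G j Q = 0,
            forall j, (j < k)%N -> G j.+1 Q <= G j Q
          & Q !=set0 -> G 0%N Q = num_points Q - 1] ]).
Proof.
move=> G; split.
  move=> k kd; split; first exact: grassmann_val_valuation.
  exact: grassmann_val_translation.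
move=> _ [n [a [la ->]]].
have cQ : compact (conv_hull a) by exact: conv_hull_compact.
have G0 : conv_hull a !=set0 -> G 0%N (conv_hull a) = num_points (conv_hull a) - 1.
  exact: grassmann_val0.
split => //.
- apply: grassmann_val_solid_angle => //; last exact: conv_hull_convex.
  by apply: unifS; rewrite -dimv_eq0 dim_rV -lt0n.
- exact: grassmann_val_top.
move=> k Qk; split => // j jk.
  by apply: grassmann_val_eq0 => //; rewrite Qk.
apply: grassmann_val_le => //; apply: leq_trans jk _.
by rewrite -Qk; apply: leq_trans (dimvS (subvf _)) _; rewrite dim_rV.
Qed.
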